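(* Let $d\ge1$, let $X,X_1,X_2,\dots$ be iid $\mathrm{Uniform}([0,1]^d)$, let $\iota$ be a finite index set, $(c_j)_{j\in\iota}$ corners of $[0,1]^d$ and $(x_j)_{j\in\iota}$ points of $[0,1]^d$. Then, as $n\to\infty$, the random vector $\bigl(Z_n^{c_j}(x_j)\bigr)_{j\in\iota}$ converges in distribution to the mean-zero multivariate Gaussian $N(0,S)$ on $\mathbb R^\iota$ with covariance $$S_{j,l}=\mathbb P\bigl(X\in\mathrm{cornerLe}(c_j,x_j)\cap\mathrm{cornerLe}(c_l,x_l)\bigr)-F^{c_j}(x_j)\,F^{c_l}(x_l),\qquad j,l\in\iota .$$
   Context: A corner of $[0,1]^d$ is a function $c:\{0,\dots,d-1\}\to\{\mathrm{true},\mathrm{false}\}$. For a corner $c$ and $x\in[0,1]^d$, $\mathrm{cornerLe}(c,x)=\{s\in[0,1]^d:\ \text{for all }k,\ s_k\ge x_k\text{ if }c(k)=\mathrm{true},\ s_k\le x_k\text{ if }c(k)=\mathrm{false}\}$, and $F^c(x)=\prod_{k=0}^{d-1}g_k(x)$ with $g_k(x)=1-x_k$ if $c(k)=\mathrm{true}$ and $g_k(x)=x_k$ otherwise. The normalized empirical process is $Z_n^c(x)=\frac{1}{\sqrt n}\sum_{i=1}^n\bigl(\mathbf 1\{X_i\in\mathrm{cornerLe}(c,x)\}-F^c(x)\bigr)$. Gaussian laws may be degenerate. *)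

(* Defs.v *)
From HB Require Import structures.
From mathcomp Require Import all_boot all_order all_algebra finmap.
From mathcomp Require Import all_classical all_reals all_analysis.

Set Implicit Arguments.
Unset Strict Implicit.
Unset Printing Implicit Defensive.

Import Order.TTheory GRing.Theory Num.Theory.
Import numFieldNormedType.Exports.

Local Open Scope classical_set_scope.
Local Open Scope ring_scope.

Definition corner (d : nat) : Type := 'I_d -> bool.

Definition unit_cube (R : realType) (d : nat) : set (d.-tuple R) :=
  [set s | forall k, 0 <= tnth s k <= 1].

Definition cornerLe (R : realType) (d : nat) (c : corner d) (x : d.-tuple R) :
    set (d.-tuple R) :=
  [set s | unit_cube s /\
    forall k, if c k then tnth x k <= tnth s k else tnth s k <= tnth x k].

Definition cornerF (R : realType) (d : nat) (c : corner d) (x : d.-tuple R) : R :=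
  \prod_(k < d) (if c k then 1 - tnth x k else tnth x k).

(* The sample is X 1, ..., X n; the term X 0 is not used. *)
Definition empirical_process (R : realType) (d : nat) (T : Type)
    (X : nat -> T -> d.-tuple R) (n : nat) (c : corner d) (x : d.-tuple R)
    (w : T) : R :=
  (Num.sqrt n%:R)^-1 *
  \sum_(1 <= i < n.+1) (\1_(cornerLe c x) (X i w) - cornerF c x).

(* measurableTypeR R and R carry the same sigma-algebra under different
   displays; uniform_prob lives on the former. *)
Definition cons_pair (R : realType) (n : nat) (p : measurableTypeR R * n.-tuple R) :
  n.+1.-tuple R := [the n.+1.-tuple R of p.1 :: p.2].

Lemma measurable_cons_pair (R : realType) (n : nat) :
  measurable_fun setT (@cons_pair R n).
Proof.
exact: (measurable_cons (T2 := R) (f := fst) (g := snd)).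
Qed.

HB.instance Definition _ (R : realType) (n : nat) :=
  isMeasurableFun.Build _ _ _ _ (@cons_pair R n) (@measurable_cons_pair R n).

(* The product of d copies of the uniform law on [0, 1]. *)
Fixpoint uniform_cube (R : realType) (d : nat) : probability (d.-tuple R) R :=
  match d with
  | 0 => \d_([tuple] : 0.-tuple R)
  | n.+1 => distribution
      (uniform_prob (@ltr01 R) \x uniform_cube R n)%E (@cons_pair R n)
  end.

Lemma uniform_cube_box (R : realType) (d : nat) (A : 'I_d -> set R) :
  (forall k, measurable (A k)) ->
  uniform_cube R d [set s | forall k, A k (tnth s k)] =
  (\prod_(k < d) uniform_prob (@ltr01 R) (A k))%E.
Proof.
elim: d A => [|d IH] A mA.
  rewrite big_ord0 /= diracE mem_set//.
  by case.
have mbox n (B : 'I_n -> set R) : (forall k, measurable (B k)) ->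
    measurable [set s : n.-tuple R | forall k, B k (tnth s k)].
  move=> mB; rewrite [X in measurable X](_ : _ =
    \bigcap_(k in [set: 'I_n]) ((fun s : n.-tuple R => tnth s k) @^-1` B k)).
    apply: fin_bigcap_measurable; first exact: finite_finset.
    by move=> k _; rewrite -[X in measurable X]setTI; exact: measurable_tnth.
  by apply/seteqP; split => s /= h k => [_|]; [exact: h|exact: (h k Logic.I)].
rewrite big_ord_recl -IH; last by move=> k; exact: mA.
have mB := mbox _ (fun k => A (lift ord0 k)) (fun k => mA _).
have E := product_measure1E (uniform_prob (@ltr01 R)) (uniform_cube R d)
  (mA ord0) mB.
rewrite -[RHS]E /= /distribution /pushforward.
congr (_ _); apply/seteqP; split => -[u s] /=.
- move=> h; split; first exact: h ord0.
  by move=> k; have := h (lift ord0 k); rewrite tnthS.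
- move=> [hu hs] k; case: (unliftP ord0 k) => [j ->|->] //.
  by rewrite tnthS.
Qed.

Definition mutually_independent (d d' : measure_display) (T : measurableType d)
    (T' : measurableType d') (R : realType) (P : probability T R) (I : choiceType)
    (X : I -> {RV P >-> T'}) : Prop :=
  forall (J : {fset I}) (A : I -> set T'), (forall i, measurable (A i)) ->
    (P (\bigcap_(i in [set` J]) (X i @^-1` A i)) =
     \prod_(i <- J) P (X i @^-1` A i))%E.

Definition iid_with_law (d d' : measure_display) (T : measurableType d)
    (T' : measurableType d') (R : realType) (P : probability T R) (I : choiceType)
    (X : I -> {RV P >-> T'}) (mu : probability T' R) : Prop :=
  mutually_independent X /\
  forall i A, measurable A -> distribution P (X i) A = mu A.

Definition borel_pow (R : realType) (I : finType) :=
  g_sigma_algebraType (@open {ptws I -> R}).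

(* The normal law with mean m and variance v; normal_prob takes the standard
   deviation, and normal_prob m 0 is not the Dirac mass at m. *)
Definition normal_law (R : realType) (m v : R) : set R -> \bar R :=
  if v == 0 then \d_m else normal_prob m (Num.sqrt v).

(* Every linear functional is normal; the case v = 0 allows degenerate laws. *)
Definition is_gaussian (R : realType) (I : finType)
    (mu : probability (borel_pow R I) R) : Prop :=
  forall t : I -> R, exists m v : R, 0 <= v /\
    forall A, measurable A ->
      mu [set y : borel_pow R I | A (\sum_j t j * y j)] = normal_law m v A.

Definition is_gaussian_law (R : realType) (I : finType)
    (mu : probability (borel_pow R I) R) (m : I -> R) (S : I -> I -> R) : Prop :=
  [/\ is_gaussian mu,
      forall j, ('E_mu[fun y : borel_pow R I => y j] = (m j)%:E)%E &
      forall j l, covariance mu (fun y : borel_pow R I => y j)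
                    (fun y : borel_pow R I => y l) = (S j l)%:E].

(* Convergence against bounded continuous functions; the sigma-algebra of
   borel_pow R I is generated by the open sets of the topology used here. *)
Definition converges_in_distribution (d : measure_display)
    (T : measurableType d) (R : realType) (P : probability T R) (I : finType)
    (Z : nat -> T -> {ptws I -> R}) (mu : probability (borel_pow R I) R) : Prop :=
  forall f : {ptws I -> R} -> R, continuous f -> bounded_fun f ->
    ('E_P[f \o Z n] @[n --> \oo] --> 'E_mu[f])%E.

(* Main.v *)
(* Each X_i enters only through its pattern, the list of the sets
   [cornerLe (c j) (x j)] that contain it, which takes finitely many values [k],
   with probabilities [p k].  The centred patterns [g k] satisfy
   [\sum_k p k * g k = 0], so the vector [\sum_k sqrt (p k) * xi_k * g k], with
   independent standard normal [xi_k], is Gaussian with the covariance [S].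

   Lindeberg's replacement compares [E F (Z_n)] with its Gaussian counterpart,
   for [F] with a uniform second-order Taylor expansion: one step changes the
   expectation by O(n^(-3/2)), and the Gaussian steps add up because
   [a * xi + b * eta] has the law of [sqrt (a^2 + b^2) * xi].

   A continuous [f] with values in [0, 1] is approximated from below, in mean,
   by such [F >= 0]: indicators of open sets are pointwise limits of functions
   [1 - \prod_(i < m) (1 - h i) ^+ m], where each nonzero [h i] is a product of
   cubic splines, positive exactly on a rational box.  This gives
   [E f (G) <= liminf E f (Z_n)], and replacing [f] by [1 - f] gives the limit;
   since only lower bounds are used, no tightness is needed. *)

Require Import Defs.
From HB Require Import structures.
From mathcomp Require Import all_boot all_order all_algebra finmap.
From mathcomp Require Import all_classical all_reals all_analysis.
From mathcomp Require Import measurable_realfun ring lra.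

Set Implicit Arguments.
Unset Strict Implicit.
Unset Printing Implicit Defensive.

Import Order.TTheory GRing.Theory Num.Theory.
Import numFieldNormedType.Exports.

Local Open Scope classical_set_scope.
Local Open Scope ring_scope.

(** The indicators of the individual patterns are dependent: their covariance matrix is
    [diag p - p p^T]. The relation [\sum_k p k * g k = 0] kills the rank-one term, which is why
    independent coefficients [xi_k] reproduce the right covariance. Writing the limit as a sum of
    one-dimensional normals along fixed vectors needs neither a density on [R^I] nor a square root
    of the covariance matrix, so degenerate laws are no special case, and every Gaussian fact
    reduces to an integral over [R].

    The Taylor constant of [F] may blow up as [F] approaches [f], so [F] has to be fixed before [n]
    grows. Hence the error of the approximation is measured under the limit law alone, a fixed
    measure where dominated convergence applies; under the law of [Z_n] only the pointwise
    inequality [F <= f] is used.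

    Gaussian and discrete averages are treated as operators on nonnegative functions. Independence
    then becomes composition, Tonelli replaces integrability conditions, and the replacement rests
    on the fact that the two kinds of operators commute. *)

Section ge0_density.
Local Open Scope ereal_scope.
Context d (T : measurableType d) (R : realType).
Variables (nu mu : {measure set T -> \bar R}) (h : T -> R).
Hypotheses (mh : measurable_fun setT h) (h0 : forall x, (0 <= h x)%R).
Hypothesis nuE : forall A, measurable A -> nu A = \int[mu]_(x in A) (h x)%:E.

Import HBNNSimple.

(** Monotone convergence along simple functions reduces the claim to the level sets of a simple
    function, where it is [nuE]. *)
Lemma ge0_integral_density (g : T -> \bar R) : measurable_fun setT g ->
  (forall x, 0 <= g x) -> \int[nu]_x g x = \int[mu]_x (g x * (h x)%:E).
Proof.
move=> mg g0; pose g_ := nnsfun_approx measurableT mg.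
have gE x : g x = limn (fun n => (g_ n x)%:E).
  by apply/esym/cvg_lim => //; exact: cvg_nnsfun_approx.
have mg_ n : measurable_fun setT (fun x => (g_ n x)%:E).
  exact/measurable_EFinP.
have ndg x : {homo (fun n => (g_ n x)%:E) : m n / (m <= n)%N >-> m <= n}.
  by move=> m n mn; rewrite lee_fin; exact/lefP/nd_nnsfun_approx.
have g_0 n x : 0 <= (g_ n x)%:E by rewrite lee_fin.
transitivity (limn (fun n => \int[nu]_x (g_ n x)%:E)).
  by rewrite -monotone_convergence//; apply: eq_integral => x _.
transitivity (limn (fun n => \int[mu]_x ((g_ n x)%:E * (h x)%:E))); last first.
  rewrite -monotone_convergence//.
  - apply: eq_integral => x _; apply/cvg_lim => //.
    by apply: cvgeMr => //; exact: cvg_nnsfun_approx.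
  - by move=> n; apply: emeasurable_funM => //; exact/measurable_EFinP.
  - by move=> n x _; by rewrite mule_ge0// lee_fin.
  - by move=> x _ m n mn; by apply: lee_wpmul2r; [rewrite lee_fin|exact: ndg].
apply: congr_lim; apply/funext => n.
transitivity (\sum_(y \in range (g_ n)) y%:E * nu (g_ n @^-1` [set y])).
  by rewrite integralT_nnsfun sintegralE.
under eq_fsbigr do rewrite nuE//.
transitivity (\int[mu]_x (\sum_(y \in range (g_ n))
    y%:E * (\1_(g_ n @^-1` [set y]) x)%:E * (h x)%:E)); last first.
  apply: eq_integral => x _; rewrite fimfunE -fsumEFin//.
  by rewrite ge0_mule_fsuml// => y; exact: nnfun_muleindic_ge0.
rewrite ge0_integral_fsum//.
- apply: eq_fsbigr => y /set_mem[z _ zy].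
  rewrite integral_mkcond -ge0_integralZl//; last 3 first.
  + apply/(measurable_restrictT (fun x => (h x)%:E)) => //.
    exact/measurable_EFinP/measurable_funTS.
  + by move=> x _; rewrite patchE; case: ifP => // _; rewrite lee_fin.
  + by rewrite lee_fin -zy.
  apply: eq_integral => x _; rewrite -muleA; congr (_ * _).
  rewrite patchE indicE; case: ifPn; first by rewrite mul1e.
  by rewrite mul0e.
- move=> y; apply: emeasurable_funM; last exact/measurable_EFinP.
  by apply: emeasurable_funM => //; exact/measurable_EFinP.
- by move=> y x _; apply: mule_ge0; rewrite ?lee_fin//; exact: nnfun_muleindic_ge0.
Qed.

End ge0_density.

(** * Affine changes of variable and the normal density *)

Section lebesgue_affine.
Local Open Scope ereal_scope.
Context (R : realType).
Local Notation leb := (@lebesgue_measure R).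

Let phi (a b x : R) : measurableTypeR R := (a * x + b)%R.

Let mphi a b : measurable_fun [set: measurableTypeR R] (phi a b).
Proof.
apply: measurable_funD => //; exact: measurable_funM.
Qed.

(** The image of Lebesgue measure under the affine map, multiplied by [a], gives []p, q]] the mass
    [q - p]; by uniqueness it is Lebesgue measure. *)
Lemma ge0_integral_lebesgue_affine (a b : R) (g : R -> \bar R) : (0 < a)%R ->
  measurable_fun [set: measurableTypeR R] g -> (forall x, 0 <= g x) ->
  \int[leb]_x g x = a%:E * \int[leb]_x g (a * x + b)%R.
Proof.
move=> a0 mg g0.
pose m : {measure set (measurableTypeR R) -> \bar R} :=
  mscale (NngNum (ltW a0)) (pushforward leb (phi a b)).
rewrite -(@ge0_integral_pushforward _ _ _ _ _ _ (mphi a b) leb setT g)//.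
rewrite -(ge0_integral_mscale _ measurableT (NngNum (ltW a0)))//.
apply: eq_measure_integral => A mA _.
rewrite [LHS](@lebesgue_measure_unique R (m (mphi a b)))// => _ [[p q] _ <-].
rewrite /m /= /mscale/= /pushforward/=.
have -> : phi a b @^-1` `]p, q] = `]((p - b) / a)%R, ((q - b) / a)%R]%classic.
  apply/seteqP; split=> x; rewrite /= !in_itv/= /phi;
  by rewrite ltr_pdivrMr// ler_pdivlMr// ltrBlDr lerBrDr mulrC.
rewrite !lebesgue_measure_itv/= !lte_fin ltr_pM2r ?invr_gt0// ltrD2r.
case: ifPn => _; last by rewrite mule0.
by rewrite -!EFinD -EFinM; congr EFin; field; rewrite gt_eqF.
Qed.

Lemma ge0_integral_lebesgue_opp (g : R -> \bar R) :
  measurable_fun [set: measurableTypeR R] g -> (forall x, 0 <= g x) ->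
  \int[leb]_x g x = \int[leb]_x g (- x)%R.
Proof.
move=> mg g0.
have mN : measurable_fun [set: measurableTypeR R] (-%R : R -> measurableTypeR R).
  exact: oppr_measurable.
rewrite -(@ge0_integral_pushforward _ _ _ _ _ _ mN leb setT g)//.
by apply: eq_measure_integral => A mA _; exact/esym/lebesgue_measureN.
Qed.

End lebesgue_affine.

Section normal_density.
Context (R : realType).
Implicit Types m s x z : R.

Lemma normal_peakE s : 0 < s -> normal_peak s = s^-1 * normal_peak 1.
Proof.
move=> s0; rewrite /normal_peak expr1n mul1r -mulrnAr sqrtrM ?sqr_ge0//.
by rewrite sqrtr_sqr gtr0_norm// invfM.
Qed.

Lemma normal_pdf_expE m s x : 0 < s ->
  normal_pdf m s x = s^-1 * normal_peak 1 * expR (- (x - m) ^+ 2 / (2 * s ^+ 2)).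
Proof.
by move=> s0; rewrite normal_pdfE ?gt_eqF//= normal_peakE// /normal_fun mulr_natl.
Qed.

Lemma normal_pdf_affine m s x : 0 < s ->
  s * normal_pdf m s (s * x + m) = normal_pdf 0 1 x.
Proof.
move=> s0; rewrite !normal_pdf_expE// invr1 mul1r !mulrA divff ?gt_eqF// mul1r.
by congr (_ * expR _); field; rewrite gt_eqF.
Qed.

(** For [x] standard normal and [z] normal around [a * x] with deviation [b], the joint density is
    disintegrated in both orders: the marginal of [z] has deviation [c], and given [z] the variable
    [x] has mean [a * z / c ^+ 2] and deviation [b / c]. *)
Lemma normal_pdf_convolution (a b c : R) x z : 0 < b -> 0 < c ->
  c ^+ 2 = a ^+ 2 + b ^+ 2 ->
  normal_pdf 0 1 x * normal_pdf (a * x) b z =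
  normal_pdf 0 c z * normal_pdf (a * z / c ^+ 2) (b / c) x.
Proof.
move=> b0 c0 cE; rewrite !normal_pdf_expE ?divr_gt0//.
rewrite mulrACA -expRD [in RHS]mulrACA -expRD; congr (_ * expR _).
  by field; rewrite !gt_eqF.
apply/eqP; rewrite -subr_eq0; apply/eqP.
(* The two exponents differ by a multiple of [a ^+ 2 + b ^+ 2 - c ^+ 2]. With this factor explicit,
   [field] proves an unconditional identity and [cE] finishes. *)
transitivity (- ((a ^+ 2 + b ^+ 2 - c ^+ 2) * (x ^+ 2 - z ^+ 2 / c ^+ 2))
              / (2 * b ^+ 2)); first by field; rewrite !gt_eqF.
by rewrite cE subrr mul0r oppr0 mul0r.
Qed.

End normal_density.

(* Locked: otherwise unification unfolds it when it meets Lebesgue measure. *)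
Definition std_normal (R : realType) : probability (measurableTypeR R) R :=
  locked (normal_prob 0 1 : probability (measurableTypeR R) R).

(** * Integrals against the standard normal law *)

Section standard_normal.
Local Open Scope ereal_scope.
Context (R : realType).
Local Notation leb := (@lebesgue_measure R).
Local Notation N := (@std_normal R).
Implicit Type g : R -> \bar R.

Lemma ge0_integral_normal_prob (m s : R) g :
  measurable_fun [set: measurableTypeR R] g -> (forall x, 0 <= g x) ->
  \int[normal_prob m s]_x g x = \int[leb]_x (g x * (normal_pdf m s x)%:E).
Proof.
move=> mg g0; apply: ge0_integral_density => //.
- exact: measurable_normal_pdf.
- by move=> x; exact: normal_pdf_ge0.
Qed.

Lemma ge0_integral_std_normal g :
  measurable_fun [set: measurableTypeR R] g -> (forall x, 0 <= g x) ->
  \int[N]_x g x = \int[leb]_x (g x * (normal_pdf 0 1 x)%:E).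
Proof. by rewrite /std_normal -lock; exact: ge0_integral_normal_prob. Qed.

Let maff (a b : R) : measurable_fun [set: measurableTypeR R]
  ((fun x => a * x + b)%R : R -> measurableTypeR R).
Proof. by apply: measurable_funD => //; exact: measurable_funM. Qed.

Lemma ge0_integral_normal_affine (m s : R) g : (0 < s)%R ->
  measurable_fun [set: measurableTypeR R] g -> (forall x, 0 <= g x) ->
  \int[N]_x g (s * x + m)%R = \int[normal_prob m s]_x g x.
Proof.
move=> s0 mg g0.
have mgs := measurableT_comp mg (maff s m).
apply: (etrans (ge0_integral_std_normal mgs (fun=> g0 _))).
apply/esym/(etrans (ge0_integral_normal_prob m s mg g0)).
rewrite (@ge0_integral_lebesgue_affine R s m)//; last 2 first.
- apply: emeasurable_funM => //; apply/measurable_EFinP.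
  exact: measurable_normal_pdf.
- by move=> x; rewrite mule_ge0// lee_fin normal_pdf_ge0.
rewrite -ge0_integralZl//.
- by apply: eq_integral => x _; rewrite muleCA -EFinM normal_pdf_affine.
- apply: emeasurable_funM => //; apply/measurable_EFinP.
  exact: (measurableT_comp (measurable_normal_pdf m s) (maff s m)).
- by move=> x _; rewrite mule_ge0// lee_fin normal_pdf_ge0.
- by rewrite lee_fin ltW.
Qed.

Lemma ge0_integral_normal_opp g :
  measurable_fun [set: measurableTypeR R] g -> (forall x, 0 <= g x) ->
  \int[N]_x g (- x)%R = \int[N]_x g x.
Proof.
move=> mg g0.
have mgN : measurable_fun [set: measurableTypeR R] (fun x : R => g (- x)%R).
  by apply: (measurableT_comp mg); exact: oppr_measurable.
apply: (etrans (ge0_integral_std_normal mgN (fun=> g0 _))).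
apply/esym/(etrans (ge0_integral_std_normal mg g0)).
apply: (etrans (ge0_integral_lebesgue_opp _ _)).
- apply: emeasurable_funM => //; apply/measurable_EFinP.
  exact: measurable_normal_pdf.
- by move=> x; rewrite mule_ge0// lee_fin normal_pdf_ge0.
- apply: eq_integral => x _; congr (_ * _%:E).
  by rewrite !normal_pdf_expE// !subr0 sqrrN.
Qed.

Lemma ge0_integral_normal_scale_norm (a : R) g :
  measurable_fun [set: measurableTypeR R] g -> (forall x, 0 <= g x) ->
  \int[N]_x g (`|a| * x)%R = \int[N]_x g (a * x)%R.
Proof.
move=> mg g0; have [a0|a0] := ger0P a => //.
have mga : measurable_fun [set: measurableTypeR R] (fun x : R => g (a * x)%R).
  by apply: (measurableT_comp mg); apply: measurable_funM.
rewrite -(ge0_integral_normal_opp mga)//.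
by apply: eq_integral => x _; rewrite mulNr mulrN.
Qed.

(** Substitute [z = a * x + b * y] in the inner integral and exchange the integrals;
    [normal_pdf_convolution] leaves the marginal density of [z] times a conditional density in [x],
    which integrates to 1. *)
Lemma ge0_integral_normal_convolution (a b : R) g :
  measurable_fun [set: measurableTypeR R] g -> (forall x, 0 <= g x) ->
  \int[N]_x \int[N]_y g (a * x + b * y)%R =
  \int[N]_x g (Num.sqrt (a ^+ 2 + b ^+ 2) * x)%R.
Proof.
move=> mg g0.
have maff1 c d : measurable_fun [set: measurableTypeR R]
    (fun y : R => g (c * y + d)%R) by exact: (measurableT_comp mg (maff c d)).
(* For [b = 0] the inner variable has no density; only the sign of [a] has to be removed. For
   [b < 0] the symmetry of the normal law reduces to [- b]. *)
have [->|bN0] := eqVneq b 0%R.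
  rewrite expr0n addr0 sqrtr_sqr ge0_integral_normal_scale_norm//.
  apply: eq_integral => x _; under eq_integral do rewrite mul0r addr0.
  by rewrite integral_cst// [X in _ * X](probability_setT N) mule1.
wlog b0 : b bN0 / (0 < b)%R.
  move=> wlg; have [b0|b0] := ltP 0%R b; first exact: wlg.
  have bN : (0 < - b)%R by rewrite oppr_gt0 lt_neqAle bN0.
  rewrite -(sqrrN b); apply: etrans (wlg _ _ bN); last by rewrite oppr_eq0.
  apply: eq_integral => x _.
  transitivity (\int[N]_y g (b * y + a * x)%R).
    by apply: eq_integral => y _; rewrite addrC.
  apply: (etrans (esym (ge0_integral_normal_opp (maff1 _ _) _))) => //.
  by apply: eq_integral => y _; rewrite mulrN mulNr addrC.
pose c := Num.sqrt (a ^+ 2 + b ^+ 2).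
have cE : (c ^+ 2 = a ^+ 2 + b ^+ 2)%R by rewrite sqr_sqrtr// addr_ge0 ?sqr_ge0.
have c0 : (0 < c)%R by rewrite sqrtr_gt0 ltr_wpDl ?sqr_ge0// exprn_gt0.
have mp1 : measurable_fun [set: measurableTypeR R * measurableTypeR R]
    (fun p => normal_pdf (a * p.1) b p.2 : R).
  rewrite [X in measurable_fun _ X](_ : _ =
    (fun p => normal_pdf 0 b (p.2 - a * p.1)%R)); last first.
    by apply/funext => p; rewrite !normal_pdf_expE// subr0.
  apply: (measurableT_comp (measurable_normal_pdf 0 b)).
  by apply: measurable_funB => //; exact: measurable_funM.
pose F (p : measurableTypeR R * measurableTypeR R) : \bar R :=
  g p.2 * (normal_pdf (a * p.1) b p.2)%:E.
pose F' (p : measurableTypeR R * measurableTypeR R) : \bar R :=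
  F p * (normal_pdf 0 1 p.1)%:E.
have mF : measurable_fun setT F.
  apply: emeasurable_funM; last exact/measurable_EFinP.
  exact: (measurableT_comp mg).
have mF' : measurable_fun setT F'.
  apply: emeasurable_funM => //; apply/measurable_EFinP.
  exact: (measurableT_comp (measurable_normal_pdf 0 1)).
have F0 p : 0 <= F p by rewrite mule_ge0// lee_fin normal_pdf_ge0.
have F'0 p : 0 <= F' p by rewrite mule_ge0// lee_fin normal_pdf_ge0.
transitivity (\int[N]_x \int[leb]_y F (x, y)).
  apply: eq_integral => x _.
  transitivity (\int[N]_y g (b * y + a * x)%R).
    by apply: eq_integral => y _; rewrite addrC.
  apply: (etrans (ge0_integral_normal_affine _ b0 mg g0)).
  exact: ge0_integral_normal_prob.
have mFx : measurable_fun setT (fun x => \int[leb]_y F (x, y)).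
  exact: (measurable_fun_fubini_tonelli_F F).
have Fx0 x : 0 <= \int[leb]_y F (x, y) by apply: integral_ge0.
apply: (etrans (ge0_integral_std_normal mFx Fx0)).
transitivity (\int[leb]_x \int[leb]_y F' (x, y)).
  apply: eq_integral => x _; rewrite -ge0_integralZr//.
    exact: (measurableT_comp mF).
  by rewrite lee_fin normal_pdf_ge0.
apply: (etrans (fubini_tonelli F' mF' F'0)).
transitivity (\int[leb]_z (g z * (normal_pdf 0 c z)%:E)).
  apply: eq_integral => z _.
  transitivity (\int[leb]_x ((g z * (normal_pdf 0 c z)%:E) *
      (normal_pdf (a * z / c ^+ 2) (b / c) x)%:E)).
    apply: eq_integral => x _.
    rewrite /F' /F /= -!muleA -!EFinM; congr (_ * _%:E).
    by rewrite mulrC (@normal_pdf_convolution _ _ _ c).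
  rewrite ge0_integralZl//.
  - by rewrite integral_normal_pdf mule1.
  - by apply/measurable_EFinP; exact: measurable_normal_pdf.
  - by move=> x _; rewrite lee_fin normal_pdf_ge0.
  - by rewrite mule_ge0// lee_fin normal_pdf_ge0.
apply: (etrans (esym (ge0_integral_normal_prob 0 c mg g0))).
apply: (etrans (esym (ge0_integral_normal_affine 0 c0 mg g0))).
by apply: eq_integral => x _; rewrite addr0.
Qed.

(** The weight turns the standard density into [s] times the density of deviation [s]. This acts as
    a generating function of [x ^+ 2], from which the moments below are drawn. *)
Lemma integral_std_normal_expR (s : R) : (0 < s)%R ->
  \int[N]_x (expR ((1 - s^-2) * x ^+ 2 / 2))%:E = s%:E.
Proof.
move=> s0.
have mE : measurable_fun [set: measurableTypeR R]
    (fun x : R => (expR ((1 - s^-2) * x ^+ 2 / 2))%:E).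
  apply/measurable_EFinP; apply: measurableT_comp => //.
  by apply: measurable_funM => //; apply: measurable_funM.
apply: (etrans (ge0_integral_std_normal mE _)).
  by move=> x; rewrite lee_fin expR_ge0.
transitivity (\int[leb]_x (s%:E * (normal_pdf 0 s x)%:E)).
  apply: eq_integral => x _; rewrite -!EFinM; congr _%:E.
  rewrite !normal_pdf_expE// mulrCA -expRD invr1 mul1r !mulrA divff ?gt_eqF//.
  by rewrite mul1r; congr (_ * expR _)%R; field; rewrite gt_eqF.
rewrite ge0_integralZl//.
- by rewrite integral_normal_pdf mule1.
- by apply/measurable_EFinP; exact: measurable_normal_pdf.
- by move=> x _; rewrite lee_fin normal_pdf_ge0.
- by rewrite lee_fin ltW.
Qed.


End standard_normal.

(** * Moments of the standard normal law *)

Section standard_normal_moments.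
Local Open Scope ereal_scope.
Context (R : realType).
Local Notation N := (@std_normal R).

Let mX (n : nat) : measurable_fun [set: measurableTypeR R] (fun x : R => (x ^+ n)%:E).
Proof. by apply/measurable_EFinP; exact: measurable_funX. Qed.

Let mexp (k : R) : measurable_fun [set: measurableTypeR R]
  (fun x : R => (expR (k * x ^+ 2 / 2))%:E).
Proof.
apply/measurable_EFinP; apply: measurableT_comp => //.
by apply: measurable_funM => //; apply: measurable_funM.
Qed.

Let sqr0 (x : R) : 0 <= (x ^+ 2)%:E. Proof. by rewrite lee_fin sqr_ge0. Qed.

Let exp0 (k x : R) : 0 <= (expR (k * x ^+ 2 / 2))%:E.
Proof. by rewrite lee_fin expR_ge0. Qed.

Let int1 : \int[N]_x 1 = 1.
Proof. by rewrite integral_cst// [X in _ * X](probability_setT N) mule1. Qed.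

(* Both bounds integrate [1 + u <= expR u] with [u = (1 - s^-2) x^2 / 2],
   and are sharp to first order as [s] tends to [1]. *)
Let upper (s : R) : (1 < s)%R ->
  1 + ((1 - s^-2) / 2)%:E * \int[N]_x (x ^+ 2)%:E <= s%:E.
Proof.
move=> s1; have s0 : (0 < s)%R by exact: lt_trans s1.
have k0 : (0 <= (1 - s^-2) / 2)%R.
  by rewrite divr_ge0// subr_ge0 invf_le1 ?exprn_gt0// exprn_ege1// ltW.
rewrite -(integral_std_normal_expR s0) -[X in X + _]int1 -ge0_integralZl//.
rewrite -ge0_integralD//; last 2 first.
- by move=> x _; rewrite mule_ge0// lee_fin.
- exact: measurable_funeM.
apply: ge0_le_integral => //.
- by move=> x _; rewrite adde_ge0// mule_ge0// lee_fin.
- by apply: emeasurable_funD => //; exact: measurable_funeM.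
move=> x _; rewrite -EFinM -EFinD lee_fin mulrAC.
exact: expR_ge1Dx.
Qed.

Let lower (s : R) : (0 < s < 1)%R ->
  1 <= s%:E + ((s^-2 - 1) / 2)%:E * \int[N]_x (x ^+ 2)%:E.
Proof.
move=> /andP[s0 s1].
have k0 : (0 <= (s^-2 - 1) / 2)%R.
  by rewrite divr_ge0// subr_ge0 invf_ge1 ?exprn_gt0// exprn_ile1// ltW.
rewrite -[X in X + _](integral_std_normal_expR s0) -[X in X <= _]int1.
rewrite -ge0_integralZl// -ge0_integralD//; last 2 first.
- by move=> x _; rewrite mule_ge0// lee_fin.
- exact: measurable_funeM.
apply: ge0_le_integral => //.
- by apply: emeasurable_funD => //; exact: measurable_funeM.
move=> x _; rewrite -EFinM -EFinD lee_fin.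
have := expR_ge1Dx ((1 - s^-2) * x ^+ 2 / 2); lra.
Qed.

(** [upper] bounds the integral above by [2 * s ^+ 2 / (s + 1)] for [s > 1], and [lower] bounds it
    below by the same expression for [s < 1]; both bounds tend to 1. In place of a limit, a suitable
    [s] refutes each possible deviation [e] from 1. *)
Lemma integral_std_normal_sqr : \int[N]_x (x ^+ 2)%:E = 1.
Proof.
have I0 : 0 <= \int[N]_x (x ^+ 2)%:E by apply: integral_ge0 => x _.
have Ifin : \int[N]_x (x ^+ 2)%:E \is a fin_num.
  (* At [s = 2] a positive multiple of the integral is bounded, so the integral is finite. *)
  have s1 : (1 < 2 :> R)%R by lra.
  rewrite ge0_fin_numE//; move: (upper s1).
  have [->|/eqP I_y] := eqVneq (\int[N]_x (x ^+ 2)%:E) +oo; last first.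
    by rewrite ltey; move/eqP: I_y.
  rewrite gt0_muley ?addey//= lte_fin divr_gt0// subr_gt0.
  by rewrite invf_lt1 ?exprn_gt0// exprn_egt1.
move: upper lower I0; rewrite -(fineK Ifin); set r := fine _ => up lo.
rewrite lee_fin => r0; congr _%:E; apply/eqP; rewrite eq_le; apply/andP; split.
- rewrite leNgt; apply/negP => r1.
  (* This keeps [s - 1] below both [e / 3] and [1 / 3], which makes [2 * s ^+ 2 / (s + 1)] smaller
     than [1 + e]. *)
  pose e := (r - 1)%R; pose s := (1 + e / (3 + 3 * e))%R.
  have e0 : (0 < e)%R by rewrite subr_gt0.
  have d0 : (0 < e / (3 + 3 * e))%R by apply: divr_gt0; lra.
  have s1 : (1 < s)%R by rewrite ltrDl.
  have := up s s1; rewrite -EFinM -EFinD lee_fin => H.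
  have : ((s + 1) * r <= 2 * s ^+ 2)%R.
    rewrite -(ler_pM2r (x := (s - 1) / (2 * s ^+ 2))); last first.
      by rewrite divr_gt0 ?subr_gt0// mulr_gt0// exprn_gt0//; lra.
    suff -> : ((s + 1) * r * ((s - 1) / (2 * s ^+ 2)) = (1 - s^-2) / 2 * r)%R.
      suff -> : (2 * s ^+ 2 * ((s - 1) / (2 * s ^+ 2)) = s - 1)%R by lra.
      by field; lra.
    by field; lra.
  have rE : r = (1 + e)%R by rewrite /e; ring.
  have dE : ((s - 1) * (3 + 3 * e) = e)%R by rewrite /s; field; lra.
  rewrite rE; have : (0 < s - 1)%R by lra.
  move: dE; set D := (s - 1)%R; have -> : s = (1 + D)%R by rewrite /D; ring.
  nra.
- rewrite leNgt; apply/negP => r1.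
  (* To first order in [e], [2 * s ^+ 2] falls below 2 by [e] but [(1 + s) * r] by [9 / 4 * e]; the
     quadratic terms are harmless because [e <= 1]. *)
  pose e := (1 - r)%R; pose s := (1 - e / 4)%R.
  have e0 : (0 < e)%R by rewrite subr_gt0.
  have e1 : (e <= 1)%R by rewrite /e; lra.
  have s01 : (0 < s < 1)%R by rewrite /s; lra.
  have := lo s s01; rewrite -EFinM -EFinD lee_fin => H.
  have : (2 * s ^+ 2 <= (1 + s) * r)%R.
    rewrite -(ler_pM2r (x := (1 - s) / (2 * s ^+ 2))); last first.
      by rewrite divr_gt0 ?subr_gt0// ?mulr_gt0// ?exprn_gt0//; lra.
    suff -> : ((1 + s) * r * ((1 - s) / (2 * s ^+ 2)) = (s^-2 - 1) / 2 * r)%R.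
      suff -> : (2 * s ^+ 2 * ((1 - s) / (2 * s ^+ 2)) = 1 - s)%R by lra.
      by field; lra.
    by field; lra.
  have rE : r = (1 - e)%R by rewrite /e; ring.
  by rewrite rE /s; nra.
Qed.

(** For [s = sqrt 2] the weight of [integral_std_normal_expR] is [expR (x ^+ 2 / 4)], which is at
    least [(1 + x ^+ 2 / 8) ^+ 2]. The factor 64 makes the leading term of this square [x ^+ 4],
    enough to dominate the cube. *)
Lemma integral_std_normal_abs3 : \int[N]_x (`|x| ^+ 3)%:E < +oo.
Proof.
pose s := Num.sqrt (2 : R).
have s0 : (0 < s)%R by rewrite sqrtr_gt0.
have bound (x : R) :
    (`|x| ^+ 3 <= 1 + 64 * expR ((1 - s^-2) * x ^+ 2 / 2))%R.
  have -> : ((1 - s^-2) * x ^+ 2 / 2 = x ^+ 2 / 8 + x ^+ 2 / 8)%R.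
    by rewrite sqr_sqrtr//; field.
  rewrite expRD -(real_normK (num_real x)).
  have := expR_ge1Dx (`|x| ^+ 2 / 8); set E := expR _.
  have := normr_ge0 x; move: `|x|%R => y y0 hE.
  have h2 : ((1 + y ^+ 2 / 8) ^+ 2 <= E * E)%R.
    by rewrite expr2 ler_pM// addr_ge0// divr_ge0// sqr_ge0.
  have := sqr_ge0 (y ^+ 2 - y); have := sqr_ge0 y; nra.
apply: (@le_lt_trans _ _
   (\int[N]_x (1 + 64%:E * (expR ((1 - s^-2) * x ^+ 2 / 2))%:E))).
  apply: ge0_le_integral => //.
  - apply/measurable_EFinP; apply: measurable_funX.
    exact: (measurableT_comp (@normr_measurable R setT)).
  - by apply: emeasurable_funD => //; exact: measurable_funeM.
  - by move=> x _; rewrite -EFinM -EFinD lee_fin.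
rewrite ge0_integralD//; last exact: measurable_funeM.
by rewrite int1 ge0_integralZl// integral_std_normal_expR// -EFinM -EFinD ltry.
Qed.

Lemma integrable_std_normal_id : N.-integrable setT (fun x : R => x%:E).
Proof.
apply/integrableP; split; first exact: (mX 1).
apply: (@le_lt_trans _ _ (\int[N]_x (1 + (x ^+ 2)%:E))).
  apply: ge0_le_integral => //.
  - by apply: measurableT_comp => //; exact: (mX 1).
  - exact: emeasurable_funD.
  - move=> x _; rewrite -EFinD abse_EFin lee_fin -(real_normK (num_real x)).
    have := sqr_ge0 (`|x| - 1)%R; have := normr_ge0 x; nra.
by rewrite ge0_integralD// int1 integral_std_normal_sqr ltry.
Qed.

Lemma integral_std_normal_id : \int[N]_x x%:E = 0.
Proof.
have fpos := integrable_fin_num measurableT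
  (integrable_funepos measurableT integrable_std_normal_id).
rewrite integralE.
have <- : \int[N]_x ((EFin : R -> \bar R)^\+ x) = \int[N]_x (EFin^\- x).
  rewrite -[LHS]ge0_integral_normal_opp//.
  - by apply: eq_integral => x _; rewrite funeposE funenegE EFinN.
  - by apply: measurable_funepos; exact: (mX 1).
by rewrite subee.
Qed.

End standard_normal_moments.

(** * Rational boxes and Borel measurability on [R^I] *)

Section rational_boxes.
Context (R : realType) (I : finType).

Definition rational_box (q : {ffun I -> rat} * nat) : set (I -> R) :=
  [set x | forall j, `|x j - ratr (q.1 j)| < q.2.+1%:R^-1].

(** The cubes around [x] generate a filter that converges to [x] in each coordinate. Since the
    topology is the supremum of the coordinate topologies, the filter converges to [x] and contains
    all its neighbourhoods. *)
Lemma nbhs_ptws_cube (x : {ptws I -> R}) (U : set {ptws I -> R}) : nbhs x U ->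
  exists n : nat, [set y | forall j, `|y j - x j| < n.+1%:R^-1] `<=` U.
Proof.
pose cube n : set (I -> R) := [set y | forall j, `|y j - x j| < n.+1%:R^-1].
pose F : set_system {ptws I -> R} := [set A | exists n, cube n `<=` A].
have FF : Filter F.
  split; first by exists 0%N.
  - move=> A B [m mA] [n nB]; exists (maxn m n) => y ymn; split.
    + apply: mA => j; apply: lt_le_trans (ymn j) _.
      by rewrite lef_pV2 ?posrE// ler_nat ltnS leq_maxl.
    + apply: nB => j; apply: lt_le_trans (ymn j) _.
      by rewrite lef_pV2 ?posrE// ler_nat ltnS leq_maxr.
  - by move=> A B AB [n nA]; exists n; exact: subset_trans AB.
suff : F --> x by move=> + xU => /(_ _ xU).
apply/cvg_sup => i.
rewrite cvg_image; last first.
  by rewrite eqEsubset; split=> v // _; exists (fun=> v).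
move=> W /nbhs_ballP[e /= e0 eW]; exists (@^~ i @^-1` W); last first.
  by rewrite eqEsubset; split => [_ [? ? <-//]|v Wv]; exists (fun=> v).
have [n ne] : exists n : nat, n.+1%:R^-1 < e.
  by have [n _ /(_ n (leqnn n)) ne] := near_infty_natSinv_lt (PosNum e0); exists n.
exists n => y /(_ i) yx; apply: eW; rewrite /ball/= distrC.
exact: lt_trans ne.
Qed.

Lemma open_rational_box (U : set {ptws I -> R}) (x : I -> R) :
  open U -> U x -> exists q, rational_box q x /\ rational_box q `<=` U.
Proof.
move=> oU Ux.
have [n nU] : exists n : nat, [set y | forall j, `|y j - x j| < n.+1%:R^-1] `<=` U.
  by apply: nbhs_ptws_cube; exact: open_nbhs_nbhs.
(* The radius [1 / (2 * n + 2)] is half of [1 / (n + 1)]: the displacement of the centre and the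
   radius of the box together stay within the cube. *)
have e0 : 0 < (n.*2.+1).+1%:R^-1 :> R by [].
have /choice[q qx] : forall j, exists q : rat,
    `|x j - ratr q| < (n.*2.+1).+1%:R^-1.
  move=> j; have /rat_in_itvoo[q] : x j - (n.*2.+1).+1%:R^-1 < x j.
    by rewrite ltrBlDr ltrDl.
  rewrite in_itv/= => /andP[q1 q2]; exists q.
  by rewrite ger0_norm ?subr_ge0 ?(ltW q2)// ltrBlDr -ltrBlDl.
exists ([ffun j => q j], n.*2.+1); split => [j|y yq]; first by rewrite ffunE.
apply: nU => j; have := yq j; rewrite ffunE /= => yqj.
rewrite -(subrK (ratr (q j)) (y j)) -addrA.
apply: le_lt_trans (ler_normD _ _) _.
have -> : n.+1%:R^-1 = (n.*2.+1).+1%:R^-1 + (n.*2.+1).+1%:R^-1 :> R.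
  by rewrite -[_.+2]/(n.+1).*2 -mul2n natrM; field; rewrite nat1r pnatr_eq0.
by rewrite ltrD// distrC.
Qed.

Lemma rational_boxes_countable : countable [set: {ffun I -> rat} * nat].
Proof. exact: countableP. Qed.

Lemma measurable_borel_pow_coord (j : I) :
  measurable_fun [set: borel_pow R I] (fun y : borel_pow R I => y j).
Proof.
apply: (measurability _ (RGenOInfty.measurableE R)) => _ [_ [a ->] <-].
rewrite setTI; apply: sub_sigma_algebra.
have /continuousP : continuous (fun y : {ptws I -> R} => y j).
  exact: (@proj_continuous _ (fun=> R)).
by apply; exact: interval_open.
Qed.

(** The sigma-algebra is generated by open sets, not by coordinates. Countability of the rational
    boxes bridges the gap: an open set is the union of the boxes that it contains, and a box is a
    finite intersection of coordinate conditions. *)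
Lemma measurable_fun_borel_pow d (T : measurableType d) (h : T -> borel_pow R I) :
  (forall j, measurable_fun [set: T] (fun t => h t j : R)) ->
  measurable_fun [set: T] h.
Proof.
move=> mh; apply: (@measurability _ _ T (borel_pow R I) setT h
  (@open {ptws I -> R}) (erefl _)).
move=> _ [U oU <-]; rewrite setTI.
have -> : h @^-1` U = \bigcup_q (if `[< rational_box q `<=` U >]
    then h @^-1` rational_box q else set0).
  apply/seteqP; split => [t Ut|t [q _]]; last by case: asboolP => // qU /qU.
  have [q [qt qU]] := open_rational_box oU Ut.
  by exists q => //; rewrite asboolT.
apply: countable_bigcupT_measurable; first exact: rational_boxes_countable.
move=> q; case: asboolP => // _.
have -> : h @^-1` rational_box q =
    \bigcap_(j in [set: I]) ((fun t => `|h t j - ratr (q.1 j)|) @^-1`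
      `]-oo, q.2.+1%:R^-1[%classic).
  apply/seteqP; split => t /= qt j; last by have := qt j Logic.I; rewrite /= in_itv.
  by move=> _; rewrite /= in_itv/=; exact: qt.
apply: fin_bigcap_measurable; first exact: finite_finset.
move=> j _; rewrite -[X in measurable X]setTI.
have mg : measurable_fun setT (fun t => `|h t j - ratr (q.1 j)|).
  by apply: measurableT_comp => //; apply: measurable_funB.
exact: mg.
Qed.

Lemma continuous_measurable_borel_pow (f : {ptws I -> R} -> R) :
  continuous f -> measurable_fun [set: borel_pow R I] (f : borel_pow R I -> R).
Proof.
move=> /continuousP cf.
apply: (measurability _ (RGenOInfty.measurableE R)) => _ [_ [a ->] <-].
by rewrite setTI; apply: sub_sigma_algebra; apply: cf; exact: interval_open.
Qed.

End rational_boxes.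

(** * Gaussian shift operators and the Gaussian sum *)

Section gaussian_sum.
Local Open Scope ereal_scope.
Context (R : realType) (I : finType).
Local Notation N := (@std_normal R).
Local Notation V := (borel_pow R I).
Implicit Types (v w x y : I -> R) (l : seq (I -> R)) (F : V -> \bar R).

Definition measurable_ge0 d (T : measurableType d) (f : T -> \bar R) :=
  measurable_fun [set: T] f /\ forall z, 0 <= f z.

(** This is convolution with the normal law on the line spanned by [v]. As an operator on functions,
    adding an independent Gaussian vector becomes composition. *)
Definition gshift v F : V -> \bar R :=
  fun x => \int[N]_r F (fun j => x j + r * v j)%R.

Definition gshifts l F : V -> \bar R := foldr gshift F l.

Lemma measurable_ge0_comp d d' (T : measurableType d) (T' : measurableType d')
    (f : T' -> \bar R) (h : T -> T') :
  measurable_ge0 f -> measurable_fun [set: T] h -> measurable_ge0 (f \o h).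
Proof. by move=> [mf f0] mh; split=> [|z]; [exact: measurableT_comp|exact: f0]. Qed.

Lemma measurable_line v : measurable_fun [set: V * measurableTypeR R]
  (fun p => (fun j => p.1 j + p.2 * v j)%R : V).
Proof.
apply: measurable_fun_borel_pow => j; apply: measurable_funD.
  exact: (measurableT_comp (measurable_borel_pow_coord j)).
exact: measurable_funM.
Qed.

Lemma measurable_line_coef v x : measurable_fun [set: measurableTypeR R]
  (fun r => (fun j => x j + r * v j)%R : V).
Proof.
apply: measurable_fun_borel_pow => j; apply: measurable_funD => //.
exact: measurable_funM.
Qed.

Lemma measurable_ge0_gshift v F : measurable_ge0 F -> measurable_ge0 (gshift v F).
Proof.
move=> mF; have [mG G0] := measurable_ge0_comp mF (measurable_line v).
split; first exact: (measurable_fun_fubini_tonelli_F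
   (fun p : V * measurableTypeR R => F (fun j => p.1 j + p.2 * v j)%R) mG).
by move=> x; apply: integral_ge0 => r _; exact: mF.2.
Qed.

Lemma measurable_ge0_gshifts l F : measurable_ge0 F -> measurable_ge0 (gshifts l F).
Proof. by move=> mF; elim: l => //= v l IH; exact: measurable_ge0_gshift. Qed.

Lemma gshiftC v w F : measurable_ge0 F ->
  gshift v (gshift w F) = gshift w (gshift v F).
Proof.
move=> mF; apply/funext => x.
pose h (p : measurableTypeR R * measurableTypeR R) : V :=
  (fun j => x j + p.1 * v j + p.2 * w j)%R.
have mh : measurable_fun setT h.
  apply: measurable_fun_borel_pow => j; apply: measurable_funD; last first.
    exact: measurable_funM.
  by apply: measurable_funD => //; exact: measurable_funM.
have [mG G0] := measurable_ge0_comp mF mh.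
apply: (etrans (fubini_tonelli _ mG G0)).
apply: eq_integral => r _; apply: eq_integral => s _ /=.
by congr F; apply/funext => j; rewrite addrAC.
Qed.

Lemma gshift_gshifts v l F : measurable_ge0 F ->
  gshift v (gshifts l F) = gshifts l (gshift v F).
Proof.
move=> mF; elim: l => //= w l IH; rewrite gshiftC ?IH//.
exact: measurable_ge0_gshifts.
Qed.

Lemma gshift_scale_merge (a b : R) v F : measurable_ge0 F ->
  gshift (fun j => a * v j)%R (gshift (fun j => b * v j)%R F) =
  gshift (fun j => Num.sqrt (a ^+ 2 + b ^+ 2) * v j)%R F.
Proof.
move=> mF; apply/funext => x.
have [mg g0] := measurable_ge0_comp mF (measurable_line_coef v x).
have := ge0_integral_normal_convolution a b mg g0; rewrite /= => E.
rewrite /gshift; apply: etrans (etrans E _).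
  apply: eq_integral => r _; apply: eq_integral => s _.
  by congr F; apply/funext => j; ring.
by apply: eq_integral => r _; congr F; apply/funext => j; ring.
Qed.

Definition vscale (a : R) l : seq (I -> R) := [seq (fun j => a * v j)%R | v <- l].

(** Shifts along different vectors commute, so the two shifts along the same vector can be brought
    together and merged by the one-dimensional convolution. *)
Lemma gshifts_scale_merge (a b : R) l F : measurable_ge0 F ->
  gshifts (vscale a l) (gshifts (vscale b l) F) =
  gshifts (vscale (Num.sqrt (a ^+ 2 + b ^+ 2)) l) F.
Proof.
move=> mF; elim: l => //= v l IH.
rewrite -gshift_gshifts; last exact: measurable_ge0_gshifts.
rewrite IH gshift_scale_merge//; exact: measurable_ge0_gshifts.
Qed.

(** Under the form [t], a shift along [v] becomes a one-dimensional normal shift of deviation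
    [\sum_j t j * v j], and by convolution the variances add. *)
Lemma gshifts_linear_form l (t : I -> R) (g : R -> \bar R) x :
  measurable_ge0 (g : measurableTypeR R -> \bar R) ->
  gshifts l (fun y => g (\sum_j t j * y j)%R) x =
  \int[N]_r g (\sum_j t j * x j +
    Num.sqrt (\sum_(v <- l) (\sum_j t j * v j) ^+ 2) * r)%R.
Proof.
move=> [mg g0]; elim: l x => [|v l IH] x /=.
  rewrite big_nil sqrtr0; under eq_integral do rewrite mul0r addr0.
  by rewrite integral_cst// [X in _ * X](probability_setT N) mule1.
rewrite big_cons.
pose a : R := (\sum_j t j * v j)%R.
pose s := Num.sqrt (\sum_(v <- l) (\sum_j t j * v j) ^+ 2).
have -> : (\sum_(v <- l) (\sum_j t j * v j) ^+ 2 = s ^+ 2)%R.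
  by rewrite sqr_sqrtr// sumr_ge0// => w _; rewrite sqr_ge0.
have mg' : measurable_fun [set: measurableTypeR R]
    (fun r : R => g (\sum_j t j * x j + r)%R).
  by apply: (measurableT_comp mg); exact: measurable_funD.
have E := ge0_integral_normal_convolution a s mg' (fun=> g0 _).
apply: etrans (etrans E _) => //.
apply: eq_integral => r _; rewrite IH; apply: eq_integral => r' _.
congr g; rewrite addrA; congr (_ + _)%R.
rewrite /a mulr_suml -big_split; apply: eq_bigr => j _ /=; ring.
Qed.

Lemma gshifts_scale (s : R) l F x y :
  gshifts l (fun z => F (fun j => x j + s * z j)%R) y =
  gshifts (vscale s l) F (fun j => x j + s * y j)%R.
Proof.
elim: l y => //= v l IH y; rewrite /gshift; apply: eq_integral => r _.
by rewrite IH; congr gshifts; apply/funext => j; ring.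
Qed.

Definition shift_map v (p : measurableTypeR R * V) : V :=
  fun j => (p.1 * v j + p.2 j)%R.

Lemma measurable_shift_map v : measurable_fun setT (shift_map v).
Proof.
apply: measurable_fun_borel_pow => j; apply: measurable_funD.
  exact: measurable_funM.
exact: (measurableT_comp (measurable_borel_pow_coord j)).
Qed.

HB.instance Definition _ v :=
  isMeasurableFun.Build _ _ _ _ (shift_map v) (measurable_shift_map v).

(* The law of the sum of the independent vectors [xi_v * v], where [v] runs
   over [l] and each [xi_v] is standard normal. *)
Fixpoint gaussian_sum l : probability V R :=
  match l with
  | [::] => \d_((fun=> 0%R) : V)
  | v :: l => distribution (N \x gaussian_sum l) (shift_map v)
  end.

Lemma integral_gaussian_sum l F : measurable_ge0 F ->
  \int[gaussian_sum l]_y F y = gshifts l F (fun=> 0%R).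
Proof.
(* The base point is generalized because each shift of the list moves it. *)
suff H x : measurable_ge0 F ->
    \int[gaussian_sum l]_y F (fun j => x j + y j)%R = gshifts l F x.
  move=> mF; rewrite -(H _ mF); apply: eq_integral => y _.
  by congr F; apply/funext => j; rewrite add0r.
elim: l x => [|v l IH] x mF /=.
  have mx : measurable_fun [set: V] (fun y => (fun j => x j + y j)%R : V).
    apply: measurable_fun_borel_pow => j; apply: measurable_funD => //.
    exact: measurable_borel_pow_coord.
  rewrite integral_dirac//; last exact: (measurable_ge0_comp mF mx).1.
  rewrite diracE mem_set// mul1e; congr F; apply/funext => j; exact: addr0.
have mx : measurable_fun [set: V] (fun y => (fun j => x j + y j)%R : V).
  apply: measurable_fun_borel_pow => j; apply: measurable_funD => //.
  exact: measurable_borel_pow_coord.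
have [mG G0] := measurable_ge0_comp mF mx.
rewrite (ge0_integral_pushforward (measurable_shift_map v))//=; last first.
  by move=> y _; exact: G0.
have [mH H0] := measurable_ge0_comp (conj mG G0) (measurable_shift_map v).
apply: (etrans (fubini_tonelli1 _ mH H0)).
apply: eq_integral => r _; rewrite /fubini_F /=.
rewrite -IH//; apply: eq_integral => y _ /=.
by congr F; apply/funext => j; rewrite addrA.
Qed.

End gaussian_sum.

(** * Linear forms, mean and covariance of the Gaussian sum *)

Section gaussian_sum_law.
Local Open Scope ereal_scope.
Context (R : realType) (I : finType) (l : seq (I -> R)).
Local Notation N := (@std_normal R).
Local Notation V := (borel_pow R I).
Local Notation mu := (gaussian_sum l).
Implicit Types (t : I -> R) (g : R -> \bar R).

Definition gaussian_sd t : R :=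
  Num.sqrt (\sum_(v <- l) (\sum_j t j * v j) ^+ 2).

Lemma measurable_linear_form t :
  measurable_fun [set: V] (fun y : V => (\sum_j t j * y j)%R).
Proof.
apply: measurable_sum => j; apply: measurable_funM => //.
exact: measurable_borel_pow_coord.
Qed.

Lemma ge0_integral_linear_form t g :
  measurable_fun [set: measurableTypeR R] g -> (forall r, 0 <= g r) ->
  \int[mu]_y g (\sum_j t j * y j)%R = \int[N]_r g (gaussian_sd t * r)%R.
Proof.
move=> mg g0; rewrite integral_gaussian_sum; last first.
  split => [|y]; last exact: g0.
  exact: (measurableT_comp mg (measurable_linear_form t)).
rewrite gshifts_linear_form; last by split.
apply: eq_integral => r _; congr g.
by rewrite big1 ?add0r// => j _; rewrite mulr0.
Qed.

Lemma integral_linear_form t g : measurable_fun [set: measurableTypeR R] g ->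
  \int[mu]_y g (\sum_j t j * y j)%R = \int[N]_r g (gaussian_sd t * r)%R.
Proof.
move=> mg; rewrite [LHS]integralE [RHS]integralE; congr (_ - _).
  apply: etrans (etrans (ge0_integral_linear_form t
    (measurable_funepos mg) (funepos_ge0 g)) _).
    by apply: eq_integral => y _; rewrite !funeposE.
  by apply: eq_integral => y _; rewrite !funeposE.
apply: etrans (etrans (ge0_integral_linear_form t
  (measurable_funeneg mg) (funeneg_ge0 g)) _).
  by apply: eq_integral => y _; rewrite !funenegE.
by apply: eq_integral => y _; rewrite !funenegE.
Qed.

Lemma gaussian_sum_gaussian : is_gaussian mu.
Proof.
move=> t; exists 0%R, (gaussian_sd t ^+ 2)%R; split; first exact: sqr_ge0.
move=> A mA.
have mA' : (measurable : set (set (measurableTypeR R))) A by [].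
have mV : measurable [set y : V | A (\sum_j t j * y j)%R].
  by rewrite -[X in measurable X]setTI; exact: (measurable_linear_form t).
have mind : measurable_fun [set: measurableTypeR R] (fun r : R => (\1_A r : R)%:E).
  by apply/measurable_EFinP; exact: measurable_indic.
have ind0 (r : R) : 0 <= (\1_A r : R)%:E by rewrite lee_fin.
have -> : mu [set y : V | A (\sum_j t j * y j)%R] =
    \int[mu]_y (\1_A (\sum_j t j * y j)%R)%:E.
  transitivity (\int[mu]_y (\1_[set y : V | A (\sum_j t j * y j)%R] y)%:E) => //.
  by rewrite integral_indic// setIT.
rewrite (ge0_integral_linear_form t mind ind0) /normal_law.
rewrite sqrtr_sqr ger0_norm ?sqrtr_ge0// sqrf_eq0.
have [->|s0] := eqVneq (gaussian_sd t) 0%R.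
  under eq_integral do rewrite mul0r.
  by rewrite integral_cst// [X in _ * X](probability_setT N) mule1.
have s_gt0 : (0 < gaussian_sd t)%R by rewrite lt_neqAle eq_sym s0 sqrtr_ge0.
have := ge0_integral_normal_affine 0 s_gt0 mind ind0.
have -> : \int[normal_prob 0 (gaussian_sd t)]_r (\1_A r)%:E =
    normal_prob 0 (gaussian_sd t) A.
  by rewrite integral_indic// setIT.
by move=> <-; apply: eq_integral => r _; rewrite addr0.
Qed.

Lemma integrable_linear_form t :
  mu.-integrable setT (fun y : V => (\sum_j t j * y j)%:E).
Proof.
apply/integrableP; split.
  by apply/measurable_EFinP; exact: measurable_linear_form.
rewrite (ge0_integral_linear_form t (g := fun r => `|r%:E|))//; last first.
  by apply: measurableT_comp => //; exact/measurable_EFinP.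
have /integrableP[_] := integrableZl measurableT (gaussian_sd t)
  (integrable_std_normal_id R).
by under eq_integral do rewrite -EFinM.
Qed.

Lemma expectation_linear_form t : 'E_mu[fun y : V => (\sum_j t j * y j)%R] = 0.
Proof.
rewrite unlock (integral_linear_form t (g := EFin)); last first.
  exact/measurable_EFinP.
under eq_integral do rewrite EFinM.
by rewrite integralZl ?integral_std_normal_id ?mule0//; exact: integrable_std_normal_id.
Qed.

Lemma integral_linear_form_sqr t :
  \int[mu]_y ((\sum_j t j * y j) ^+ 2)%:E =
  (\sum_(v <- l) (\sum_j t j * v j) ^+ 2)%:E.
Proof.
have msq : measurable_fun [set: measurableTypeR R] (fun r : R => (r ^+ 2)%:E).
  by apply/measurable_EFinP; exact: measurable_funX.
rewrite (ge0_integral_linear_form t msq); last first.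
  by move=> r; rewrite lee_fin sqr_ge0.
under eq_integral do rewrite exprMn EFinM.
rewrite ge0_integralZl//.
- rewrite integral_std_normal_sqr mule1 sqr_sqrtr// sumr_ge0// => v _.
  exact: sqr_ge0.
- by move=> r _; rewrite lee_fin sqr_ge0.
- by rewrite lee_fin sqr_ge0.
Qed.

Lemma integral_linear_form_abs3 t :
  \int[mu]_y (`|\sum_j t j * y j| ^+ 3)%:E < +oo.
Proof.
have m3 : measurable_fun [set: measurableTypeR R] (fun r : R => (`|r| ^+ 3)%:E).
  apply/measurable_EFinP; apply: measurable_funX.
  exact: (measurableT_comp (@normr_measurable R setT)).
rewrite (ge0_integral_linear_form t m3); last first.
  by move=> r; rewrite lee_fin exprn_ge0.
under eq_integral do rewrite normrM exprMn EFinM.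
rewrite ge0_integralZl//.
- rewrite lte_mul_pinfty ?integral_std_normal_abs3// lee_fin exprn_ge0.
Qed.

End gaussian_sum_law.

Section gaussian_sum_moments.
Local Open Scope ereal_scope.
Context (R : realType) (I : finType) (l : seq (I -> R)).
Local Notation V := (borel_pow R I).
Local Notation mu := (gaussian_sum l).

Let delta (j k : I) : R := (k == j)%:R.

Let delta_sum j (y : I -> R) : (\sum_k delta j k * y k = y j)%R.
Proof.
rewrite (bigD1 j)//= /delta eqxx mul1r big1 ?addr0// => k /negPf ->.
by rewrite mul0r.
Qed.

Lemma expectation_gaussian_coord j : 'E_mu[fun y : V => y j] = 0.
Proof.
rewrite (_ : (fun y : V => _) = (fun y : V => \sum_k delta j k * y k)%R).
  exact: expectation_linear_form.
by apply/funext => y; rewrite delta_sum.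
Qed.

Lemma integral_gaussian_coord_abs3 j : \int[mu]_y (`|y j| ^+ 3)%:E < +oo.
Proof.
apply: le_lt_trans (integral_linear_form_abs3 l (delta j)).
by rewrite le_eqVlt; apply/orP; left; apply/eqP; apply: eq_integral => y _;
  rewrite delta_sum.
Qed.

Lemma integrable_linear_form_sqr (t : I -> R) :
  mu.-integrable setT (fun y : V => ((\sum_j t j * y j) ^+ 2)%:E).
Proof.
apply/integrableP; split.
  apply/measurable_EFinP; apply: measurable_funX; exact: measurable_linear_form.
under eq_integral do rewrite gee0_abs ?lee_fin ?sqr_ge0//.
by rewrite integral_linear_form_sqr ltry.
Qed.

(** Polarization: mixed second moments are obtained from squares of linear forms, which the
    one-dimensional computation covers. *)
Let polar j k : (fun y : V => (y j * y k)%:E) = (fun y : V => 2^-1%:E *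
  (((\sum_i (delta j i + delta k i) * y i) ^+ 2)%:E -
   (((\sum_i delta j i * y i) ^+ 2)%:E + ((\sum_i delta k i * y i) ^+ 2)%:E)))%E.
Proof.
apply/funext => y; under eq_bigr do rewrite mulrDl.
by rewrite big_split /= !delta_sum -?EFinD -?EFinB -?EFinM; congr _%:E; field.
Qed.

Lemma integrable_gaussian_coordM j k :
  mu.-integrable setT (fun y : V => (y j * y k)%:E).
Proof.
rewrite polar.
apply: integrableZl => //; apply: integrableB => //.
  exact: integrable_linear_form_sqr.
by apply: integrableD => //; exact: integrable_linear_form_sqr.
Qed.

Lemma integral_gaussian_coordM j k :
  \int[mu]_y (y j * y k)%:E = (\sum_(v <- l) v j * v k)%:E.
Proof.
rewrite polar.
have isq t := integrable_linear_form_sqr t.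
rewrite integralZl//; last first.
  by apply: integrableB => //; exact: integrableD.
rewrite integralB//; last exact: integrableD.
rewrite integralD// !integral_linear_form_sqr -?EFinD -?EFinB -?EFinM.
congr _%:E; rewrite -big_split -sumrB mulr_sumr; apply: eq_bigr => v _ /=.
rewrite !delta_sum; under eq_bigr do rewrite mulrDl.
by rewrite big_split /= !delta_sum; field.
Qed.

Lemma gaussian_sum_law : is_gaussian_law mu (fun=> 0%R)
  (fun j k => \sum_(v <- l) v j * v k)%R.
Proof.
split; [exact: gaussian_sum_gaussian|exact: expectation_gaussian_coord|].
move=> j k; rewrite covariance.unlock !expectation_gaussian_coord /=.
rewrite unlock -integral_gaussian_coordM; apply: eq_integral => y _.
by congr EFin; rewrite /GRing.mul /= !subr0.
Qed.

End gaussian_sum_moments.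

(** * Functions with a uniform second-order Taylor expansion *)

Section smooth_functions.
Context (R : realType) (I : finType).
Implicit Types (F G : (I -> R) -> R) (x h : I -> R).

Definition norm1 h : R := \sum_j `|h j|.

Definition lin (a : I -> R) h : R := \sum_j a j * h j.

Definition quad (b : I -> I -> R) h : R := \sum_j \sum_k b j k * (h j * h k).

(** Estimates stand in for derivatives, so that no differentiability has to be proved. The bounds on
    [F], [lin] and [quad] accompany the remainder because they are what makes the class stable under
    products. *)
Definition taylor2 (C : R) F x (a : I -> R) (b : I -> I -> R) :=
  [/\ `|F x| <= C, (forall h, `|lin a h| <= C * norm1 h),
    (forall h, `|quad b h| <= C * norm1 h ^+ 2) &
    (forall h, `|F (fun j => x j + h j) - F x - lin a h - quad b h|
       <= C * norm1 h ^+ 3)].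

(* [b] absorbs the factor 1/2 of the second-order Taylor term. *)
Definition smooth F :=
  measurable_fun [set: borel_pow R I] (F : borel_pow R I -> R) /\
  exists C : R, 0 <= C /\ forall x, exists a b, taylor2 C F x a b.

Lemma norm1_ge0 h : 0 <= norm1 h.
Proof. by apply: sumr_ge0. Qed.

Lemma le_norm1 h j : `|h j| <= norm1 h.
Proof. by rewrite /norm1 (bigD1 j)//= lerDl sumr_ge0. Qed.

Lemma taylor2_le C D F x a b : C <= D -> taylor2 C F x a b -> taylor2 D F x a b.
Proof.
move=> CD [h1 h2 h3 h4]; split => [|h|h|h].
- exact: le_trans CD.
- by apply: le_trans (h2 h) _; rewrite ler_wpM2r ?norm1_ge0.
- by apply: le_trans (h3 h) _; rewrite ler_wpM2r ?exprn_ge0 ?norm1_ge0.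
- by apply: le_trans (h4 h) _; rewrite ler_wpM2r ?exprn_ge0 ?norm1_ge0.
Qed.

Lemma smooth_cst (c : R) : smooth (fun=> c).
Proof.
split; first exact: measurable_cst.
exists `|c|; split => // x; exists (fun=> 0), (fun _ _ => 0).
have lin0 h : lin (fun=> 0) h = 0 by apply: big1 => j _; rewrite mul0r.
have quad0 h : quad (fun _ _ => 0) h = 0.
  by apply: big1 => j _; apply: big1 => k _; rewrite mul0r.
split => // h; rewrite ?lin0 ?quad0 ?subrr ?subr0 ?normr0;
  by rewrite ?mulr_ge0 ?exprn_ge0 ?norm1_ge0.
Qed.

Lemma smoothD F G : smooth F -> smooth G -> smooth (fun x => F x + G x).
Proof.
move=> [mF [C [C0 hF]]] [mG [D [D0 hG]]]; split; first exact: measurable_funD.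
exists (C + D); split => [|x]; first exact: addr_ge0.
have [a [b [F1 F2 F3 F4]]] := hF x; have [a' [b' [G1 G2 G3 G4]]] := hG x.
exists (fun j => a j + a' j), (fun j k => b j k + b' j k).
have linD h : lin (fun j => a j + a' j) h = lin a h + lin a' h.
  by rewrite -big_split; apply: eq_bigr => j _; rewrite mulrDl.
have quadD h : quad (fun j k => b j k + b' j k) h = quad b h + quad b' h.
  rewrite -big_split; apply: eq_bigr => j _; rewrite -big_split.
  by apply: eq_bigr => k _; rewrite mulrDl.
split => [|h|h|h]; rewrite ?linD ?quadD ?mulrDl.
- by apply: le_trans (ler_normD _ _) _; exact: lerD.
- by apply: le_trans (ler_normD _ _) _; exact: lerD.
- by apply: le_trans (ler_normD _ _) _; exact: lerD.
- set u := F (fun j => _); set v := G (fun j => _).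
  have -> : u + v - (F x + G x) - (lin a h + lin a' h) - (quad b h + quad b' h) =
    (u - F x - lin a h - quad b h) + (v - G x - lin a' h - quad b' h) by ring.
  by apply: le_trans (ler_normD _ _) _; exact: lerD (F4 h) (G4 h).
Qed.

(* The first- and second-order remainders are bounded by powers of [n] both for
   small and, by boundedness of [f], for large increments. *)
Let remainders (C n f f0 l b : R) : 0 <= C -> 0 <= n ->
  `|f| <= C -> `|f0| <= C -> `|l| <= C * n -> `|b| <= C * n ^+ 2 ->
  `|f - f0 - l - b| <= C * n ^+ 3 ->
  `|f - f0| <= 4 * C * n /\ `|f - f0 - l| <= 3 * C * n ^+ 2.
Proof.
move=> C0 n0 hf hf0 hl hb hr.
have e2 : f - f0 - l = (f - f0 - l - b) + b by ring.
have e1 : f - f0 = (f - f0 - l) + l by ring.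
have c1 : `|f - f0| <= 2 * C by have := ler_normB f f0; lra.
have c2 : `|f - f0 - l| <= 2 * C + C * n by have := ler_normB (f - f0) l; lra.
have c3 : `|f - f0 - l| <= C * n ^+ 3 + C * n ^+ 2.
  by rewrite e2; have := ler_normD (f - f0 - l - b) b; lra.
have c4 : `|f - f0| <= `|f - f0 - l| + C * n.
  by rewrite {1}e1; have := ler_normD (f - f0 - l) l; lra.
have Cn : 0 <= C * n by exact: mulr_ge0.
have Cn2 : 0 <= C * n * n by exact: mulr_ge0.
have [n1|n1] := leP n 1.
- have d1 : C * n ^+ 3 <= C * n ^+ 2.
    by rewrite ler_wpM2l// ler_wiXn2l.
  have d2 : C * n ^+ 2 <= C * n by rewrite ler_wpM2l// -[leRHS]expr1 ler_wiXn2l.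
  by split; lra.
- have d2 : C * n <= C * n ^+ 2.
    by rewrite ler_wpM2l// -[leLHS]expr1 ler_weXn2l// ltW.
  have d1 : C <= C * n by rewrite ler_peMr// ltW.
  by split; lra.
Qed.

Lemma smoothM F G : smooth F -> smooth G -> smooth (fun x => F x * G x).
Proof.
move=> [mF [C [C0 hF]]] [mG [D [D0 hG]]]; split; first exact: measurable_funM.
pose K := C + D; have K0 : 0 <= K by exact: addr_ge0.
exists (9 * K ^+ 2); split => [|x]; first by rewrite mulr_ge0// exprn_ge0.
have [a [b hFx]] := hF x; have [a' [b' hGx]] := hG x.
have hFK y : `|F y| <= K.
  have [c [d [hy _ _ _]]] := hF y; apply: le_trans hy _.
  by rewrite /K lerDl.
have hGK y : `|G y| <= K.
  have [c [d [hy _ _ _]]] := hG y; apply: le_trans hy _.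
  by rewrite /K lerDr.
have /(taylor2_le (D := K))[//|_ F2 F3 F4] := hFx; first by rewrite /K lerDl.
have /(taylor2_le (D := K))[//|_ G2 G3 G4] := hGx; first by rewrite /K lerDr.
pose A j := F x * a' j + G x * a j.
pose B j k := F x * b' j k + G x * b j k + a j * a' k.
have linE h : lin A h = F x * lin a' h + G x * lin a h.
  rewrite /lin !mulr_sumr -big_split; apply: eq_bigr => j _.
  by rewrite /A /=; ring.
have quadE h : quad B h =
    F x * quad b' h + G x * quad b h + lin a h * lin a' h.
  rewrite /quad /lin mulr_suml !mulr_sumr -!big_split; apply: eq_bigr => j _.
  rewrite !mulr_sumr -!big_split; apply: eq_bigr => k _ /=.
  by rewrite /B; ring.
have prod (p q c d : R) : 0 <= c -> 0 <= d -> `|p| <= c -> `|q| <= d ->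
  `|p * q| <= c * d by move=> *; rewrite normrM ler_pM.
exists A, B; split => [|h|h|h]; rewrite ?linE ?quadE.
- apply: le_trans (prod _ _ _ _ K0 K0 (hFK x) (hGK x)) _.
  by have := mulr_ge0 K0 K0; rewrite expr2; lra.
- have n0 := norm1_ge0 h; have Kn := mulr_ge0 K0 n0.
  have := ler_normD (F x * lin a' h) (G x * lin a h).
  have := prod _ _ _ _ K0 Kn (hFK x) (G2 h).
  have := prod _ _ _ _ K0 Kn (hGK x) (F2 h).
  by have := mulr_ge0 K0 Kn; rewrite expr2; lra.
- have n0 := norm1_ge0 h; have Kn := mulr_ge0 K0 n0.
  have Kn2 : 0 <= K * norm1 h ^+ 2 by rewrite mulr_ge0// exprn_ge0.
  have := ler_normD (F x * quad b' h + G x * quad b h) (lin a h * lin a' h).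
  have := ler_normD (F x * quad b' h) (G x * quad b h).
  have := prod _ _ _ _ K0 Kn2 (hFK x) (G3 h).
  have := prod _ _ _ _ K0 Kn2 (hGK x) (F3 h).
  have := prod _ _ _ _ Kn Kn (F2 h) (G2 h).
  by have := mulr_ge0 K0 Kn2; rewrite !exprS expr0; lra.
- have n0 := norm1_ge0 h; have Kn := mulr_ge0 K0 n0.
  have Kn2 : 0 <= K * norm1 h ^+ 2 by rewrite mulr_ge0// exprn_ge0.
  have Kn3 : 0 <= K * norm1 h ^+ 3 by rewrite mulr_ge0// exprn_ge0.
  have [r1 r2] := remainders K0 n0 (hFK (fun j => x j + h j)) (hFK x)
    (F2 h) (F3 h) (F4 h).
  have r1' : 0 <= 4 * K * norm1 h by lra.
  have r2' : 0 <= 3 * K * norm1 h ^+ 2 by lra.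
  have t1 := prod _ _ _ _ K0 Kn3 (hFK (fun j => x j + h j)) (G4 h).
  have t2 := prod _ _ _ _ K0 Kn3 (hGK x) (F4 h).
  have t3 := prod _ _ _ _ Kn r2' (G2 h) r2.
  have t4 := prod _ _ _ _ Kn2 r1' (G3 h) r1.
  move: t1 t2 t3 t4.
  set f := F (fun j => _); set g := G (fun j => _).
  set f0 := F x; set g0 := G x.
  set lf := lin a h; set lg := lin a' h; set bf := quad b h; set bg := quad b' h.
  set n := norm1 h => t1 t2 t3 t4.
  (* Each product on the right has order 3 in [n]: bounded times third-order remainder, twice, then
     first-order term times second-order remainder, and second-order term times increment. The
     coefficients [1 + 1 + 3 + 4] explain the constant 9. *)
  have -> : f * g - f0 * g0 - (f0 * lg + g0 * lf) -
      (f0 * bg + g0 * bf + lf * lg) =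
    f * (g - g0 - lg - bg) + g0 * (f - f0 - lf - bf) +
    lg * (f - f0 - lf) + bg * (f - f0) by ring.
  move: t1 t2 t3 t4.
  set p1 := f * _; set p2 := g0 * _; set p3 := lg * _; set p4 := bg * _.
  have := ler_normD (p1 + p2 + p3) p4; have := ler_normD (p1 + p2) p3.
  have := ler_normD p1 p2.
  by rewrite !exprS expr0; lra.
Qed.

Lemma smooth_exp F m : smooth F -> smooth (fun x => F x ^+ m).
Proof.
move=> sF; elim: m => [|m IH]; first exact: smooth_cst.
rewrite (_ : (fun x => _) = (fun x => F x * F x ^+ m)); first exact: smoothM.
by apply/funext => x; rewrite exprS.
Qed.

Lemma smooth_prod (J : Type) (s : seq J) (F : J -> (I -> R) -> R) :
  (forall i, smooth (F i)) -> smooth (fun x => \prod_(i <- s) F i x).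
Proof.
move=> sF; elim: s => [|i s IH].
  rewrite (_ : (fun x => _) = (fun=> 1)); first exact: smooth_cst.
  by apply/funext => x; rewrite big_nil.
rewrite (_ : (fun x => _) = (fun x => F i x * \prod_(i <- s) F i x)).
  exact: smoothM.
by apply/funext => x; rewrite big_cons.
Qed.

End smooth_functions.

(** * The cubic B-spline *)

Section cubic_spline.
Context (R : realType).
Implicit Types t u : R.

Definition posp t : R := Num.max 0 t.

(* The unnormalised cubic B-spline on [0, 4]. *)
Definition diff4 (p : R -> R) t : R :=
  p t - 4 * p (t - 1) + 6 * p (t - 2) - 4 * p (t - 3) + p (t - 4).

Definition spline : R -> R := diff4 (fun t => posp t ^+ 3).

Lemma pospP t : (0 <= t /\ posp t = t) \/ (t <= 0 /\ posp t = 0).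
Proof.
rewrite /posp; have [t0|t0] := leP 0 t; [by left|right].
by split=> //; exact: ltW.
Qed.

(** The second derivative of [posp t ^+ 3] is [6 * posp t], Lipschitz with constant 6, so the
    remainder is at most [6 / 3!] times the cube of the increment. The proof goes through the signs
    of [u], [t] and [t + u]. *)
Lemma posp_cube_taylor t u :
  `|posp (t + u) ^+ 3 - posp t ^+ 3 - 3 * posp t ^+ 2 * u - 3 * posp t * u ^+ 2|
  <= `|u| ^+ 3.
Proof.
have abs (v w : R) : - w <= v <= w -> `|v| <= w by rewrite ler_norml.
have cube (a b : R) : a <= b -> a * a * a <= b * b * b.
  move=> ab; rewrite -subr_ge0.
  have -> : b * b * b - a * a * a = (b - a) * (a * a + a * b + b * b) by ring.
  by rewrite mulr_ge0 ?subr_ge0//; nra.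
have tu : t <= 0 -> t + u <= u by lra.
have ut : 0 <= t -> u <= t + u by lra.
have [u0|u0] := leP 0 u.
- rewrite (ger0_norm u0); apply: abs; rewrite !exprS expr0.
  have := cube _ _ u0.
  have [[h1 ->]|[h1 ->]] := pospP (t + u); have := cube _ _ h1;
  have [[h2 ->]|[h2 ->]] := pospP t; first [have := cube _ _ (ut h2) | idtac];
  first [have := cube _ _ (tu h2) | idtac]; lra.
- rewrite (ltr0_norm u0); apply: abs; rewrite !exprS expr0.
  have := cube _ _ (ltW u0).
  have [[h1 ->]|[h1 ->]] := pospP (t + u); have := cube _ _ h1;
  have [[h2 ->]|[h2 ->]] := pospP t; first [have := cube _ _ (ut h2) | idtac];
  first [have := cube _ _ (tu h2) | idtac]; lra.
Qed.

(** [diff4] is linear and commutes with translations, so it carries over the expansion of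
    [posp t ^+ 3]; the absolute values of its weights sum to 16. It remains to bound the spline and
    its two coefficients. *)
Lemma spline_taylor : exists C : R, 0 <= C /\ forall t, exists a b,
  [/\ `|spline t| <= C, `|a| <= C, `|b| <= C &
    forall u, `|spline (t + u) - spline t - a * u - b * u ^+ 2| <= C * `|u| ^+ 3].
Proof.
(* The bound is opaque: [1024 : R] is a unary numeral. *)
have [C [C0 CE]] : exists C : R, 0 <= C /\ C = 32 * 32.
  by exists (32 * 32); split; [exact: mulr_ge0|reflexivity].
exists C; split => // t.
exists (diff4 (fun t => 3 * posp t ^+ 2) t), (diff4 (fun t => 3 * posp t) t).
have rem u : `|spline (t + u) - spline t - diff4 (fun t => 3 * posp t ^+ 2) t * u
    - diff4 (fun t => 3 * posp t) t * u ^+ 2| <= C * `|u| ^+ 3.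
  pose r s := posp (s + u) ^+ 3 - posp s ^+ 3 - 3 * posp s ^+ 2 * u
    - 3 * posp s * u ^+ 2.
  have rb s : - `|u| ^+ 3 <= r s <= `|u| ^+ 3.
    by rewrite -ler_norml; exact: posp_cube_taylor.
  have -> : spline (t + u) - spline t - diff4 (fun t => 3 * posp t ^+ 2) t * u
      - diff4 (fun t => 3 * posp t) t * u ^+ 2 = diff4 r t.
    rewrite /spline /diff4 /r.
    have sh c : t + u - c = t - c + u by ring.
    by rewrite !sh; ring.
  rewrite ler_norml /diff4.
  have := rb t; have := rb (t - 1); have := rb (t - 2); have := rb (t - 3).
  have := rb (t - 4); have : 0 <= `|u| ^+ 3 by exact: exprn_ge0.
  set w := `|u| ^+ 3 => w0 *.
  have Cw : 16 * w <= C * w by rewrite ler_wpM2r// CE; lra.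
  by apply/andP; split; lra.
suff [h1 h2 h3] : [/\ `|spline t| <= C,
    `|diff4 (fun t => 3 * posp t ^+ 2) t| <= C &
    `|diff4 (fun t => 3 * posp t) t| <= C] by [].
(* To the right of 4 no positive part is truncated, and a fourth difference annihilates polynomials
   of degree at most 3. To the left of 4 all arguments [posp (t - c)] lie in [[0, 4]]. *)
have [t4|t4] := leP 4 t.
  have E c : c <= 4 -> posp (t - c) = t - c by move=> c4; rewrite /posp max_r//; lra.
  have E0 : posp t = t by rewrite /posp max_r//; lra.
  have z1 : spline t = 0 by rewrite /spline /diff4 !E ?E0; try lra; ring.
  have z2 : diff4 (fun t => 3 * posp t ^+ 2) t = 0.
    by rewrite /diff4 !E ?E0; try lra; ring.
  have z3 : diff4 (fun t => 3 * posp t) t = 0.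
    by rewrite /diff4 !E ?E0; try lra; ring.
  by rewrite z1 z2 z3 normr0; split.
have p4 c : 0 <= c -> 0 <= posp (t - c) <= 4.
  by move=> c0; have [[? ->]|[? ->]] := pospP (t - c); lra.
have p4_0 : 0 <= posp t <= 4 by have := p4 0 (lexx 0); rewrite subr0.
have sq (p : R) : 0 <= p <= 4 -> 0 <= p ^+ 2 <= 16 by rewrite !exprS expr0; nra.
have cu (p : R) : 0 <= p <= 4 -> 0 <= p ^+ 3 <= 64 by rewrite !exprS expr0; nra.
have c1 : 0 <= 1 :> R by []. have c2 : 0 <= 2 :> R by [].
have c3 : 0 <= 3 :> R by []. have c4 : 0 <= 4 :> R by [].
rewrite /spline /diff4 !ler_norml; split.
- have := cu _ p4_0; have := cu _ (p4 1 c1); have := cu _ (p4 2 c2).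
  have := cu _ (p4 3 c3); have := cu _ (p4 4 c4); lra.
- have := sq _ p4_0; have := sq _ (p4 1 c1); have := sq _ (p4 2 c2).
  have := sq _ (p4 3 c3); have := sq _ (p4 4 c4); lra.
- have := p4_0; have := p4 1 c1; have := p4 2 c2.
  have := p4 3 c3; have := p4 4 c4; lra.
Qed.

Lemma spline_eq0 t : ~ (0 < t < 4) -> spline t = 0.
Proof.
move=> /negP; rewrite negb_and -!leNgt => /orP[t0|t4]; rewrite /spline /diff4.
  have E c : 0 <= c -> posp (t - c) = 0 by move=> c4; rewrite /posp max_l//; lra.
  have E0 : posp t = 0 by rewrite /posp max_l.
  by rewrite !E ?E0; try lra; ring.
have E c : c <= 4 -> posp (t - c) = t - c by move=> c4; rewrite /posp max_r//; lra.
have E0 : posp t = t by rewrite /posp max_r//; lra.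
by rewrite !E ?E0; try lra; ring.
Qed.

(** On each unit interval the spline is an explicit cubic. The inner two are written in [t - 1] and
    [3 - t], which stay in [[0, 1]]; on the last one the vanishing of the full fourth difference
    leaves [(4 - t) ^+ 3]. *)
Lemma spline_gt0 t : 0 < t < 4 -> 0 < spline t.
Proof.
move=> /andP[t0 t4]; rewrite /spline /diff4.
have E (c : R) : c <= t -> posp (t - c) = t - c by move=> ?; rewrite /posp max_r//; lra.
have Z (c : R) : t <= c -> posp (t - c) = 0 by move=> ?; rewrite /posp max_l//; lra.
have E0 : posp t = t by rewrite /posp max_r//; lra.
rewrite E0 (Z 4) ?(ltW t4)//.
have [t1|t1] := leP t 1.
  rewrite (Z 1)// (Z 2) ?(Z 3); try lra.
  by have := exprn_gt0 3 t0; lra.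
have [t2|t2] := leP t 2.
  rewrite (E 1) ?(Z 2) ?(Z 3); try lra.
  have : 0 < t - 1 <= 1 by lra.
  have -> : t ^+ 3 = (t - 1 + 1) ^+ 3 by rewrite subrK.
  by move: (t - 1) => s s01; rewrite !exprS expr0; nra.
have [t3|t3] := leP t 3.
  rewrite (E 1) ?(E 2) ?(Z 3); try lra.
  have : 0 <= 3 - t < 1 by lra.
  have -> : t ^+ 3 = (3 - (3 - t)) ^+ 3 by rewrite opprB addrC subrK.
  have -> : (t - 1) ^+ 3 = (2 - (3 - t)) ^+ 3 by congr (_ ^+ 3); ring.
  have -> : (t - 2) ^+ 3 = (1 - (3 - t)) ^+ 3 by congr (_ ^+ 3); ring.
  by move: (3 - t) => s s01; rewrite !exprS expr0; nra.
rewrite (E 1) ?(E 2) ?(E 3); try lra.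
have -> : t ^+ 3 - 4 * (t - 1) ^+ 3 + 6 * (t - 2) ^+ 3 - 4 * (t - 3) ^+ 3 + 0 ^+ 3
  = (4 - t) ^+ 3 by ring.
by rewrite exprn_gt0// subr_gt0.
Qed.

Lemma spline_ge0 t : 0 <= spline t.
Proof.
have [/spline_gt0/ltW//|] := boolP (0 < t < 4).
by move=> /negP/spline_eq0 ->.
Qed.

Lemma measurable_spline : measurable_fun [set: R] spline.
Proof.
have mp c : measurable_fun [set: R] (fun t => posp (t - c) ^+ 3).
  apply: measurable_funX; apply: measurable_maxr => //.
  exact: measurable_funB.
have mp0 : measurable_fun [set: R] (fun t => posp t ^+ 3).
  by apply: measurable_funX; apply: measurable_maxr.
rewrite /spline /diff4; apply: measurable_funD => //.
apply: measurable_funB; last exact: measurable_funM.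
by apply: measurable_funD; [apply: measurable_funB => //|]; apply: measurable_funM.
Qed.

End cubic_spline.

(** * Bumps supported on rational boxes *)

Section smooth_bumps.
Context (R : realType) (I : finType).
Implicit Types x : I -> R.

Lemma smooth_spline_coord (s b : R) (j : I) :
  smooth (fun x : I -> R => spline (s * x j + b)).
Proof.
split.
  apply: (measurableT_comp (@measurable_spline R)); apply: measurable_funD => //.
  by apply: measurable_funM => //; exact: measurable_borel_pow_coord.
have [C [C0 hC]] := spline_taylor R.
(* Since [M >= 1], the single factor [M ^+ 3] dominates every power of [s] produced by the chain
   rule up to order 3. *)
pose M : R := 1 + `|s|; have M1 : 1 <= M by rewrite lerDl.
have sM : `|s| <= M by rewrite lerDr.
have MM k : `|s| ^+ k <= M ^+ k by rewrite lerXn2r ?nnegrE// (le_trans ler01).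
have M0 : 0 <= M by exact: le_trans M1.
pose K := C * M ^+ 3.
have CK k : (k <= 3)%N -> C * M ^+ k <= K.
  by move=> k3; rewrite ler_wpM2l// ler_weXn2l.
exists K; split => [|x]; first by rewrite mulr_ge0// exprn_ge0.
have [a' [b' [h1 h2 h3 h4]]] := hC (s * x j + b).
exists (fun k => (k == j)%:R * (a' * s)),
  (fun k l => (k == j)%:R * (l == j)%:R * (b' * s ^+ 2)).
have linE h : lin (fun k => (k == j)%:R * (a' * s)) h = a' * (s * h j).
  rewrite /lin (bigD1 j)//= eqxx big1 ?addr0 => [|k /negPf ->].
    by rewrite mul1r mulrA.
  by rewrite !mul0r.
have quadE h : quad (fun k l => (k == j)%:R * (l == j)%:R * (b' * s ^+ 2)) h =
    b' * (s * h j) ^+ 2.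
  rewrite /quad (bigD1 j)//= [X in _ + X]big1 ?addr0 => [|k /negPf ->]; last first.
    by apply: big1 => l _; rewrite !mul0r.
  rewrite (bigD1 j)//= big1 ?addr0 => [|k /negPf ->]; last by rewrite !(mul0r, mulr0).
  by rewrite eqxx !mul1r; ring.
have term (c : R) h k : `|c| <= C -> (k <= 3)%N ->
    `|c * (s * h j) ^+ k| <= K * norm1 h ^+ k.
  move=> cC k3; rewrite exprMn normrM normrM !normrX mulrA ler_pM ?mulr_ge0 ?exprn_ge0//.
    by apply: le_trans (CK k k3); rewrite ler_pM ?exprn_ge0.
  by rewrite lerXn2r ?nnegrE ?norm1_ge0 ?le_norm1.
split => [|h|h|h]; rewrite ?linE ?quadE.
- by apply: le_trans h1 _; rewrite ler_peMr// exprn_ege1.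
- exact: (term _ h 1%N).
- exact: (term _ h 2%N).
- have -> : s * (x j + h j) + b = s * x j + b + s * h j by ring.
  apply: le_trans (h4 _) _; rewrite -normrX.
  rewrite -[X in X * _](ger0_norm C0) -normrM.
  by apply: (term C h 3%N); rewrite ?ger0_norm.
Qed.

Lemma smooth_bump (q : {ffun I -> rat} * nat) : exists h : (I -> R) -> R,
  [/\ smooth h, forall x, 0 <= h x <= 1 & forall x, 0 < h x <-> rational_box q x].
Proof.
have [C [C0 hC]] := spline_taylor R.
(* The affine map [s * (x j - ratr (q.1 j)) + 2] sends the [j]-th side of the box onto []0, 4[],
   where the spline is positive. Dividing by [C + 1] brings the values below 1, and the summand 1
   keeps the divisor positive. *)
pose s : R := 2 * q.2.+1%:R.
pose g j (x : I -> R) := (C + 1)^-1 * spline (s * x j + (2 - s * ratr (q.1 j))).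
have C1 : 0 < (C + 1)^-1 by rewrite invr_gt0 ltr_wpDl.
have g01 j x : 0 <= g j x <= 1.
  apply/andP; split; first by rewrite mulr_ge0 ?spline_ge0 ?(ltW C1).
  rewrite /g mulrC ler_pdivrMr ?ltr_wpDl// mul1r.
  have [a [b [h1 _ _ _]]] := hC (s * x j + (2 - s * ratr (q.1 j))).
  by rewrite (le_trans (ler_norm _))// (le_trans h1)// lerDl.
have gP j x : 0 < g j x <-> `|x j - ratr (q.1 j)| < q.2.+1%:R^-1.
  have -> : (`|x j - ratr (q.1 j)| < q.2.+1%:R^-1) =
      (0 < s * x j + (2 - s * ratr (q.1 j)) < 4).
    rewrite -[X in _ < X]mul1r ltr_pdivlMr// mulrC -[X in X * _](@ger0_norm R)//.
    rewrite -normrM ltr_norml /s; move: q.2.+1%:R (x j) (ratr _) => m u v.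
    by apply/idP/idP => /andP[h1 h2]; apply/andP; split; lra.
  rewrite /g pmulr_rgt0//; split; last exact: spline_gt0.
  by apply: contraPP => /spline_eq0 ->; rewrite ltxx.
exists (fun x => \prod_j g j x); split => [|x|x].
- apply: smooth_prod => j; apply: smoothM; first exact: smooth_cst.
  exact: smooth_spline_coord.
- rewrite prodr_ge0/=; last by move=> j _; have /andP[] := g01 j x.
  by apply: prodr_ile1 => j _; exact: g01.
- split => [g0 j|xq]; last by apply: prodr_gt0 => j _; apply/gP; exact: xq.
  apply/gP; have /andP[gj _] := g01 j x.
  rewrite lt_neqAle gj andbT eq_sym; apply: contraPneq g0 => gj0.
  by rewrite (bigD1 j)//= gj0 mul0r ltxx.
Qed.

End smooth_bumps.

(** * Approximation from below by smooth functions *)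

Section lower_approximation.
Context (R : realType) (I : finType).
Local Notation V := (borel_pow R I).
Variable mu : probability V R.
Implicit Types (f g F G : V -> R) (U : set {ptws I -> R}).

(** Outside [U] every [h i] vanishes and the product is 1. A point of [U] lies in some box inside
    [U], whose factor, once its index is below [m], is a power [z ^+ m] with [z < 1] and forces the
    product to 0. *)
Lemma smooth_to_indic U : open U -> exists F : nat -> V -> R,
  [/\ forall m, smooth (F m), forall m x, 0 <= F m x <= \1_U x &
    forall x, F ^~ x @ \oo --> (\1_U x : R)].
Proof.
move=> oU; have /choice[bump bumpP] := @smooth_bump R I.
(* The boxes are enumerated by [pickle]; a number that codes no box, or a box not contained in [U],
   gets the zero function, so nothing leaks out of [U]. *)
pose h i : V -> R :=
  if @choice.unpickle ({ffun I -> rat} * nat)%type i is Some q then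
  (if `[< rational_box q `<=` U >] then bump q else fun=> 0) else fun=> 0.
have sh i : smooth (h i).
  rewrite /h; case: choice.unpickle => [q|]; last exact: smooth_cst.
  by case: asboolP => _; [have [] := bumpP q|exact: smooth_cst].
have h01 i x : 0 <= h i x <= 1.
  rewrite /h; case: choice.unpickle => [q|]; last by rewrite lexx ler01.
  by case: asboolP => _; [have [] := bumpP q|rewrite lexx ler01].
pose G m x : R := \prod_(i < m) (1 - h i x) ^+ m.
have f01 i x : 0 <= 1 - h i x <= 1 by have := h01 i x; lra.
have G01 m x : 0 <= G m x <= 1.
  have e01 i : 0 <= (1 - h i x) ^+ m <= 1.
    by have /andP[? ?] := f01 i x; rewrite exprn_ge0 ?exprn_ile1.
  rewrite prodr_ge0/=; first exact: prodr_ile1.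
  by move=> i _; have /andP[] := e01 i.
have hU i x : ~ U x -> h i x = 0.
  move=> nU; rewrite /h; case: choice.unpickle => // q; case: asboolP => // qU.
  have [_ b01 bP] := bumpP q; apply/eqP; rewrite eq_le; apply/andP; split.
    by rewrite leNgt; apply/negP => /bP /qU.
  by have /andP[] := b01 x.
have GU m x : ~ U x -> G m x = 1.
  by move=> nU; apply: big1 => i _; rewrite hU// subr0 expr1n.
exists (fun m x => 1 - G m x); split => [m|m x|x].
- rewrite (_ : (fun x => _) = (fun x => 1 + (-1) * G m x)); last first.
    by apply/funext => x; rewrite mulN1r.
  apply: smoothD; first exact: smooth_cst.
  apply: smoothM; first exact: smooth_cst.
  apply: smooth_prod => i; apply: smooth_exp.
  rewrite (_ : (fun x => _) = (fun x => 1 + (-1) * h i x)); last first.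
    by apply/funext => x; rewrite mulN1r.
  apply: smoothD; first exact: smooth_cst.
  by apply: smoothM; first exact: smooth_cst.
- rewrite indicE; have := G01 m x; case: (boolP (x \in U)) => [_|/negP xU] /=.
    by move=> ?; lra.
  by rewrite GU ?subrr ?lexx// => Ux; apply: xU; exact: mem_set.
- rewrite indicE; case: (boolP (x \in U)) => [/set_mem xU|/negP xU] /=.
    have [q [xq qU]] := open_rational_box oU xU.
    have hq : 0 < h (choice.pickle q) x.
      by rewrite /h choice.pickleK asboolT//; have [_ _ bP] := bumpP q; exact/bP.
    rewrite -[X in _ --> X]subr0; apply: cvgB; first exact: cvg_cst.
    set z := 1 - h (choice.pickle q) x.
    have z0 : 0 <= z by have /andP[] := f01 (choice.pickle q) x.
    have z1 : `|z| < 1 by rewrite ger0_norm// /z ltrBlDr ltrDl.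
    apply: (@squeeze_cvgr _ _ _ _ (fun=> 0) (fun m => z ^+ m)).
    + near=> m; have /andP[-> _] := G01 m x; rewrite /=.
      have qm : (choice.pickle q < m)%N by near: m; exact: nbhs_infty_gt.
      rewrite /G (bigD1 (Ordinal qm))//= ler_piMr ?exprn_ge0//.
      apply: prodr_ile1 => i _; have /andP[? ?] := f01 i x.
      by rewrite exprn_ge0 ?exprn_ile1.
    + exact: cvg_cst.
    + exact: cvg_expr.
  rewrite (_ : (fun m => _) = fun=> 0); first exact: cvg_cst.
  apply/funext => m; rewrite GU ?subrr// => Ux; apply: xU; exact: mem_set.
Unshelve. all: by end_near. Qed.

(** Closeness is required in mean under [mu] only, while [F <= f] holds pointwise and so passes to
    the law of every normalized sum. *)
Definition lower_approximable f := forall e : R, 0 < e -> exists F,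
  [/\ smooth F, forall x, 0 <= F x <= f x &
    (\int[mu]_x (f x)%:E <= \int[mu]_x (F x)%:E + e%:E)%E].

Lemma open_borel_pow U : open U -> measurable (U : set V).
Proof. by move=> oU; exact: sub_sigma_algebra. Qed.

Lemma lower_approximable_indic U : open U -> lower_approximable (\1_U).
Proof.
move=> oU e e0; have [F [sF FU Fcvg]] := smooth_to_indic oU.
have mU := open_borel_pow oU.
have mF m : measurable_fun [set: V] (fun x => (F m x)%:E).
  by apply/measurable_EFinP; exact: (sF m).1.
have m1 : measurable_fun [set: V] (fun x : V => (\1_U x : R)%:E).
  by apply/measurable_EFinP; exact: measurable_indic.
have [_ _ cvF] : [/\ mu.-integrable setT (fun x : V => (\1_U x : R)%:E),
  [sequence (\int[mu]_x `|(F n x)%:E - (\1_U x)%:E|)%E]_n @ \oo --> 0%E &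
  [sequence (\int[mu]_x (F n x)%:E)%E]_n @ \oo --> (\int[mu]_x (\1_U x)%:E)%E].
  apply: (@dominated_convergence _ _ _ mu setT measurableT _ _ (fun=> 1%E)) => //.
  - by apply: aeW => x _; apply/cvg_EFin; [exact: nearW|exact: Fcvg].
  - exact: finite_measure_integrable_cst.
  - apply: aeW => x n _; have /andP[F0 F1] := FU n x.
    rewrite abse_EFin lee_fin ger0_norm//; apply: le_trans F1 _.
    by rewrite indicE lern1 leq_b1.
have I1 : (\int[mu]_x (\1_U x)%:E)%E = mu U by rewrite integral_indic// setIT.
have Ifin : (\int[mu]_x (\1_U x)%:E)%E \is a fin_num.
  by rewrite I1 fin_num_measure.
have [m hm] : exists m, (\int[mu]_x (\1_U x)%:E - e%:E < \int[mu]_x (F m x)%:E)%E.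
  move: cvF; rewrite -(fineK Ifin) => /fine_cvgP[Ffin cvF].
  have re : fine (\int[mu]_x (\1_U x)%:E)%E - e < fine (\int[mu]_x (\1_U x)%:E)%E.
    by rewrite ltrBlDr ltrDl.
  have [m [Fm ltm]] := filter_ex (filterI Ffin (cvgr_gt _ cvF _ re)).
  by exists m; move: ltm; rewrite /= -EFinB -lte_fin (fineK Fm).
exists (F m); split => //.
by move: hm; rewrite lteBlDr// => /ltW.
Qed.

Lemma lower_approximableD f g : measurable_fun setT f -> measurable_fun setT g ->
  (forall x, 0 <= f x) -> (forall x, 0 <= g x) ->
  lower_approximable f -> lower_approximable g ->
  lower_approximable (fun x => f x + g x).
Proof.
move=> mf mg f0 g0 af ag e e0; have e20 : 0 < e / 2 by rewrite divr_gt0.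
have [F [sF Ff Fe]] := af _ e20; have [G [sG Gg Ge]] := ag _ e20.
exists (fun x => F x + G x); split; first exact: smoothD.
  by move=> x; have := Ff x; have := Gg x; lra.
have F0 x : 0 <= F x by have /andP[] := Ff x.
have G0 x : 0 <= G x by have /andP[] := Gg x.
under eq_integral do rewrite EFinD.
under [X in (_ <= X + _)%E]eq_integral do rewrite EFinD.
rewrite !ge0_integralD//; try (by move=> x _; rewrite lee_fin);
  try (apply/measurable_EFinP => //); [|exact: sF.1|exact: sG.1].
have -> : e%:E = ((e / 2)%:E + (e / 2)%:E)%E by rewrite -EFinD; congr _%:E; field.
by apply: le_trans (leeD Fe Ge) _; rewrite [leLHS]addeACA.
Qed.

Lemma lower_approximableZ (c : R) f : 0 < c -> measurable_fun setT f ->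
  (forall x, 0 <= f x) -> lower_approximable f ->
  lower_approximable (fun x => c * f x).
Proof.
move=> c0 mf f0 af e e0; have ec0 : 0 < e / c by rewrite divr_gt0.
have [F [sF Ff Fe]] := af _ ec0.
have F0 x : 0 <= F x by have /andP[] := Ff x.
exists (fun x => c * F x); split.
- by apply: smoothM => //; exact: smooth_cst.
- by move=> x; have /andP[F0' Ff'] := Ff x; rewrite mulr_ge0 ?(ltW c0)//= ler_pM2l.
under eq_integral do rewrite EFinM.
under [X in (_ <= X + _)%E]eq_integral do rewrite EFinM.
have c0e : (0 <= c%:E)%E by rewrite lee_fin ltW.
rewrite !ge0_integralZl//; try (by move=> x _; rewrite lee_fin);
  try (apply/measurable_EFinP => //); last exact: sF.1.
have -> : e%:E = (c%:E * (e / c)%:E)%E.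
  by rewrite -EFinM; congr _%:E; field; rewrite gt_eqF.
rewrite -ge0_muleDr; [|by apply: integral_ge0 => x _; rewrite lee_fin|];
  last by rewrite lee_fin ltW.
by rewrite lee_pmul2l.
Qed.

Lemma lower_approximable_sum (J : Type) (s : seq J) (f : J -> V -> R) :
  (forall i, measurable_fun setT (f i)) -> (forall i x, 0 <= f i x) ->
  (forall i, lower_approximable (f i)) ->
  lower_approximable (fun x => \sum_(i <- s) f i x).
Proof.
move=> mf f0 af; elim: s => [|i s IH].
  move=> e e0; exists (fun=> 0); split; first exact: smooth_cst.
    by move=> x; rewrite big_nil lexx.
  under eq_integral do rewrite big_nil.
  by rewrite leeDl// lee_fin ltW.
rewrite (_ : (fun x => _) = (fun x => f i x + \sum_(i <- s) f i x)); last first.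
  by apply/funext => x; rewrite big_cons.
apply: lower_approximableD => //; first exact: measurable_sum.
by move=> x; exact: sumr_ge0.
Qed.

(* The count of thresholds [1, ..., n] below [z] is [min n z] up to an error 1. *)
Let count_thresholds (z : R) n : 0 <= z ->
  if n%:R < z then \sum_(i < n) (i.+1%:R < z)%R%:R = n%:R :> R
  else z - 1 <= \sum_(i < n) (i.+1%:R < z)%R%:R <= z.
Proof.
move=> z0; elim: n => [|n IH].
  by rewrite big_ord0; case: ltP => // z0'; apply/andP; split; lra.
rewrite big_ord_recr /= -natr1; move: IH.
have [nz|nz] := ltP n%:R z => IH.
  rewrite IH; case: ltP => //= nz1.
  by rewrite addr0; apply/andP; split; lra.
rewrite ltNge (le_trans nz) ?lerDl//= addr0.
by move: IH.
Qed.

(** A layer-cake sum: [g] counts the levels [i / N] strictly below [f] and divides by [N], so it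
    lies below [f] by at most [1 / N]. Continuity makes each set [U i] open, which puts its
    indicator within reach. *)
Lemma lower_approximable_continuous f : continuous (f : {ptws I -> R} -> R) ->
  (forall x, 0 <= f x <= 1) -> lower_approximable f.
Proof.
move=> cf f01 e e0; have e20 : 0 < e / 2 by rewrite divr_gt0.
have [n _ /(_ n (leqnn n)) ne] := near_infty_natSinv_lt (PosNum e20).
pose N : R := n.+1%:R; have N0 : 0 < N by [].
pose U i : set {ptws I -> R} := [set x | i.+1%:R / N < f x].
have oU i : open (U i).
  have -> : U i = f @^-1` `]i.+1%:R / N, +oo[%classic.
    by apply/seteqP; split => x; rewrite /= in_itv/= andbT.
  by move/continuousP : cf; apply; exact: interval_open.
pose g (x : V) : R := \sum_(i < n.+1) N^-1 * \1_(U i) x.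
have gE x : g x = N^-1 * \sum_(i < n.+1) (i.+1%:R < N * f x)%R%:R.
  rewrite mulr_sumr; apply: eq_bigr => i _; rewrite indicE; congr (_ * (_)%:R).
  congr nat_of_bool; apply/idP/idP => [/set_mem|].
    by rewrite /U /= ltr_pdivrMr// mulrC.
  by move=> ?; apply/mem_set; rewrite /U /= ltr_pdivrMr// mulrC.
have gf x : g x <= f x <= g x + e / 2.
  have /andP[f0 f1] := f01 x.
  have := @count_thresholds (N * f x) n.+1 (mulr_ge0 (ltW N0) f0).
  rewrite ltNge -[leRHS]mulr1 ler_pM2l// f1 /= => /andP[c1 c2].
  rewrite gE -(ler_pM2l N0) mulVKf ?gt_eqF// c2 /=.
  rewrite -lerBlDl; apply: le_trans (ltW ne).
  rewrite -(ler_pM2l N0) mulrBr mulVKf ?gt_eqF// divff ?gt_eqF//.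
  by rewrite lerBlDr -lerBlDl.
have m1 i : measurable_fun [set: V] (\1_(U i) : V -> R).
  by apply: measurable_indic; exact: open_borel_pow.
have mg' i : measurable_fun [set: V] (fun x : V => N^-1 * \1_(U i) x).
  by apply: measurable_funM.
have g0' i (x : V) : 0 <= N^-1 * \1_(U i) x by rewrite mulr_ge0// invr_ge0 ltW.
have ag' i : lower_approximable (fun x : V => N^-1 * \1_(U i) x).
  apply: lower_approximableZ => //; first by rewrite invr_gt0.
  exact: lower_approximable_indic.
have [F [sF Fg Fe]] := lower_approximable_sum (index_enum 'I_n.+1)
  (fun i : 'I_n.+1 => mg' i) (fun i : 'I_n.+1 => g0' i)
  (fun i : 'I_n.+1 => ag' i) e20.
have F0 x : 0 <= F x by have /andP[] := Fg x.
exists F; split => // [x|].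
  by have /andP[-> Fx] := Fg x; apply: le_trans Fx _; have /andP[] := gf x.
have mg : measurable_fun [set: V] g by exact: measurable_sum.
have g0 x : 0 <= g x by have /andP[h1 h2] := Fg x; exact: le_trans h2.
apply: (@le_trans _ _ (\int[mu]_x (g x)%:E + (e / 2)%:E)%E).
  have -> : ((e / 2)%:E = \int[mu]_x (e / 2)%:E :> \bar R)%E.
    by rewrite integral_cst// [X in (_ * X)%E](probability_setT mu) mule1.
  rewrite -ge0_integralD//; last 3 first.
  - by move=> x _; rewrite lee_fin.
  - exact/measurable_EFinP.
  - by move=> x _; rewrite lee_fin ltW.
  apply: ge0_le_integral => //.
  - by move=> x _; rewrite lee_fin; have /andP[] := f01 x.
  - by apply/measurable_EFinP; exact: continuous_measurable_borel_pow.
  - apply: emeasurable_funD => //; exact/measurable_EFinP.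
  - by move=> x _; rewrite -EFinD lee_fin; have /andP[] := gf x.
have -> : e%:E = ((e / 2)%:E + (e / 2)%:E)%E by rewrite -EFinD; congr _%:E; field.
by rewrite addeA leeD2r.
Qed.

End lower_approximation.

(** * Expectations along the random walk *)

Section independent_steps.
Local Open Scope ereal_scope.
Context (R : realType) (I K : finType) d (T : measurableType d)
  (P : probability T R).
Local Notation V := (borel_pow R I).
Variables (X : nat -> T -> K) (p : K -> R) (g : K -> I -> R).
Hypothesis mX : forall i k, measurable [set w | X i w = k].
Hypothesis p_ge0 : forall k, (0 <= p k)%R.
Hypothesis indepX : forall (J : {fset nat}) (k : nat -> K),
  P (\bigcap_(i in [set` J]) [set w | X i w = k i]) = (\prod_(i <- J) p (k i))%:E.
Implicit Types (F : V -> \bar R) (x : I -> R).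

(** The transition operator of the walk with steps [s * g k]; its iterates replace the joint law of
    the steps. *)
Definition step_mean (s : R) F : V -> \bar R :=
  fun x => \sum_(k : K) (p k)%:E * F (fun j => x j + s * g k j)%R.

Definition walk m w j : R := (\sum_(1 <= i < m.+1) g (X i w) j)%R.

Lemma measurable_walk (s : R) x m :
  measurable_fun [set: T] (fun w => (fun j => x j + s * walk m w j)%R : V).
Proof.
apply: measurable_fun_borel_pow => j; apply: measurable_funD => //.
apply: measurable_funM => //; apply: measurable_sum => i.
have -> : (fun w => g (X i w) j) =
    (fun w => \sum_(k : K) g k j * \1_[set w | X i w = k] w)%R.
  apply/funext => w; rewrite (bigD1 (X i w))//= indicE mem_set// mulr1.
  rewrite big1 ?addr0// => k kX; rewrite indicE memNset ?mulr0//= => E.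
  by move: kX; rewrite E eqxx.
by apply: measurable_sum => k; apply: measurable_funM.
Qed.

Lemma measurable_ge0_step_mean s F : measurable_ge0 F ->
  measurable_ge0 (step_mean s F).
Proof.
move=> mF.
have mk k : measurable_fun [set: V] (fun x => (fun j => x j + s * g k j)%R : V).
  apply: measurable_fun_borel_pow => j; apply: measurable_funD => //.
  exact: measurable_borel_pow_coord.
split.
  apply: emeasurable_sum => k; apply: measurable_funeM.
  exact: (measurable_ge0_comp mF (mk k)).1.
by move=> x; apply: sume_ge0 => k _; rewrite mule_ge0 ?lee_fin//; exact: mF.2.
Qed.

(** The induction removes the last step, so it must remember the values of the later steps already
    removed: they form the cylinder over [J]. Splitting by the value of [X m.+1] enlarges [J] by the
    index [m.+1] and contributes the factor [p a]. *)
Lemma integral_walk_cylinder (s : R) F m (J : {fset nat}) (k : nat -> K) x :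
  measurable_ge0 F -> (forall i, i \in J -> (m < i)%N) ->
  \int[P]_(w in \bigcap_(i in [set` J]) [set w | X i w = k i])
     F (fun j => x j + s * walk m w j)%R =
  (\prod_(i <- J) p (k i))%:E * iter m (step_mean s) F x.
Proof.
move=> mF; elim: m J k x => [|m IH] J k x Jm /=.
  rewrite -indepX muleC.
  have -> : (fun w => F (fun j => x j + s * walk 0 w j)%R) = cst (F x).
    apply/funext => w; congr F; apply/funext => j.
    by rewrite /walk big_nil mulr0 addr0.
  rewrite integral_cst//; apply: fin_bigcap_measurable => //.
pose B := \bigcap_(i in [set` J]) [set w | X i w = k i].
have mB : measurable B by apply: fin_bigcap_measurable.
have BE : B = \big[setU/set0]_(a <- index_enum K) (B `&` [set w | X m.+1 w = a]).
  rewrite -big_distrr /= -bigcup_seq; apply/seteqP; split => [w Bw|w []//].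
  by split => //; exists (X m.+1 w) => //=; rewrite mem_index_enum.
rewrite -/B [in LHS]BE ge0_integral_bigsetU//=; last 5 first.
- by move=> a; exact: measurableI.
- exact: index_enum_uniq.
- by apply/trivIsetP => a b _ _ ab; apply/seteqP; split => // w [[_ wa] [_ wb]];
    move/eqP: ab; rewrite -wa -wb.
- apply: measurable_funTS.
  exact: (measurable_ge0_comp mF (measurable_walk s x m.+1)).1.
- by move=> w _; exact: mF.2.
rewrite ge0_sume_distrr; last first.
  move=> a _; rewrite mule_ge0 ?lee_fin//.
  by elim: (m) (fun j => _)%R => [|n IHn] y /=; [exact: mF.2|
    apply: sume_ge0 => b _; rewrite mule_ge0 ?lee_fin].
apply: eq_bigr => a _.
pose k' i := if i == m.+1 then a else k i.
have mJ : m.+1 \notin J by apply/negP => /Jm; rewrite ltnn.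
have k'J i : i \in J -> k' i = k i.
  by rewrite /k'; case: eqP => // ->; rewrite (negPf mJ).
have -> : B `&` [set w | X m.+1 w = a] =
    \bigcap_(i in [set` (m.+1 |` J)%fset]) [set w | X i w = k' i].
  apply/seteqP; split => [w [Bw Xw] i /=|w h].
    rewrite in_fset1U => /orP[/eqP ->|iJ]; first by rewrite /k' eqxx.
    by rewrite k'J//; exact: Bw.
  split => [i /= iJ|]; last first.
    have := h m.+1; rewrite /= /k' eqxx; apply; exact: fset1U1.
  by rewrite -k'J//; apply: h; rewrite /= in_fset1U iJ orbT.
rewrite muleA -EFinM.
have -> : ((\prod_(i <- J) p (k i)) * p a =
    \prod_(i <- (m.+1 |` J)%fset) p (k' i))%R.
  rewrite big_fsetU1//= /k' eqxx mulrC; congr (_ * _)%R.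
  by apply: eq_big_seq => i iJ; rewrite -/(k' i) k'J.
rewrite -IH.
  apply: eq_integral => w /set_mem Bw; congr F; apply/funext => j.
  have Xw : X m.+1 w = a.
    by have := Bw m.+1; rewrite /= /k' eqxx; apply; exact: fset1U1.
  by rewrite /walk big_nat_recr//= Xw mulrDr addrA addrAC.
move=> i; rewrite in_fset1U => /orP[/eqP -> //|/Jm]; exact: ltnW.
Qed.

Lemma integral_walk (s : R) F m (k0 : K) : measurable_ge0 F ->
  \int[P]_w F (fun j => s * walk m w j)%R = iter m (step_mean s) F (fun=> 0%R).
Proof.
move=> mF.
have := @integral_walk_cylinder s F m fset0 (fun=> k0) (fun=> 0%R) mF.
rewrite big_seq_fset0 mul1e => <-//.
have -> : \bigcap_(i in [set` (fset0 : {fset nat})]) [set w | X i w = k0] = setT.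
  by apply/seteqP; split => // w _ i.
by apply: eq_integral => w _; congr F; apply/funext => j; rewrite add0r.
Qed.

End independent_steps.

(** * Comparison of one Gaussian step with one discrete step *)

Section lindeberg_replacement.
Context (R : realType) (I K : finType) (p : K -> R) (g : K -> I -> R).
Hypotheses (p_ge0 : forall k, 0 <= p k) (p_sum : \sum_k p k = 1).
Hypothesis g_mean : forall j, \sum_k p k * g k j = 0.
Local Notation V := (borel_pow R I).
Implicit Types (x : I -> R) (F : V -> R) (G : V -> \bar R).

Definition limit_vectors : seq (I -> R) :=
  [seq (fun j => Num.sqrt (p k) * g k j) | k <- index_enum K].

Local Notation mu := (gaussian_sum limit_vectors).

Definition step_cov j i : R := \sum_k p k * (g k j * g k i).

Lemma limit_vectors_cov j i :
  \sum_(v <- limit_vectors) v j * v i = step_cov j i.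
Proof.
rewrite big_map; apply: eq_bigr => k _.
by rewrite mulrACA -expr2 sqr_sqrtr.
Qed.

Lemma norm1_cube h : norm1 h ^+ 3 <= #|I|%:R ^+ 3 * \sum_(j : I) `|h j| ^+ 3 :> R.
Proof.
have [j0 _|I0] := pickP {: I}; last first.
  by rewrite /norm1 !big_pred0// ?mulr0 ?expr0n// => j; have := I0 j.
have /(arg_maxP (fun j => `|h j|))[j _ jmax] : predT j0 by [].
have nj : norm1 h <= #|I|%:R * `|h j|.
  rewrite /norm1 -sum1_card natr_sum mulr_suml.
  by apply: ler_sum => i _; rewrite mul1r; exact: jmax.
apply: (@le_trans _ _ ((#|I|%:R * `|h j|) ^+ 3)).
  by rewrite lerXn2r ?nnegrE ?norm1_ge0// mulr_ge0.
by rewrite exprMn ler_wpM2l ?exprn_ge0// (bigD1 j)//= lerDl sumr_ge0.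
Qed.

Lemma measurable_norm1_cube :
  measurable_fun [set: V] (fun y : V => (norm1 y ^+ 3)%:E).
Proof.
apply/measurable_EFinP; apply: measurable_funX; apply: measurable_sum => j.
by apply: measurableT_comp => //; exact: measurable_borel_pow_coord.
Qed.

Lemma integrable_norm1_cube : mu.-integrable setT (fun y : V => (norm1 y ^+ 3)%:E).
Proof.
apply/integrableP; split; first exact: measurable_norm1_cube.
have m3 j : measurable_fun [set: V] (fun y : V => (`|y j| ^+ 3)%:E).
  apply/measurable_EFinP; apply: measurable_funX.
  by apply: measurableT_comp => //; exact: measurable_borel_pow_coord.
apply: (@le_lt_trans _ _
   (\int[mu]_y ((#|I|%:R ^+ 3)%:E * \sum_j (`|y j| ^+ 3)%:E))%E).
  apply: ge0_le_integral => //.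
  - by apply: measurableT_comp => //; exact: measurable_norm1_cube.
  - by apply: measurable_funeM; exact: emeasurable_sum.
  - move=> y _; rewrite gee0_abs ?lee_fin ?exprn_ge0 ?norm1_ge0//.
    by rewrite sumEFin -EFinM lee_fin norm1_cube.
rewrite ge0_integralZl//; last 2 first.
- exact: emeasurable_sum.
- by move=> y _; apply: sume_ge0.
rewrite ge0_integral_sum// lte_mul_pinfty ?lee_fin ?exprn_ge0//.
by apply: lte_sum_pinfty => j _; exact: integral_gaussian_coord_abs3.
Qed.

Definition gaussian_mean (s : R) G : V -> \bar R :=
  fun x => (\int[mu]_y G (fun j => x j + s * y j)%R)%E.

Let M := fine (\int[mu]_y (norm1 y ^+ 3)%:E)%E.

Let M' := \sum_k p k * norm1 (g k) ^+ 3.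

Let lin_scale a (s : R) h : lin a (fun j : I => s * h j) = s * lin a h.
Proof. by rewrite /lin mulr_sumr; apply: eq_bigr => j _; ring. Qed.

Let quad_scale b (s : R) h : quad b (fun j : I => s * h j) = s ^+ 2 * quad b h.
Proof.
rewrite /quad mulr_sumr; apply: eq_bigr => j _.
by rewrite mulr_sumr; apply: eq_bigr => i _; ring.
Qed.

Let norm1_scale (s : R) h : 0 <= s -> norm1 (fun j : I => s * h j) = s * norm1 h.
Proof.
by move=> s0; rewrite /norm1 mulr_sumr; apply: eq_bigr => j _;
  rewrite normrM ger0_norm.
Qed.

Lemma measurable_ge0_smooth F : smooth F -> (forall x, 0 <= F x) ->
  measurable_ge0 (EFin \o F : V -> \bar R).
Proof.
by move=> sF F0; split=> [|x]; [apply/measurable_EFinP; exact: sF.1|rewrite lee_fin].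
Qed.

Lemma measurable_translate_scale x (s : R) :
  measurable_fun [set: V] (fun y : V => (fun j => x j + s * y j)%R : V).
Proof.
apply: measurable_fun_borel_pow => j; apply: measurable_funD => //.
by apply: measurable_funM => //; exact: measurable_borel_pow_coord.
Qed.

(** Integrating the upper Taylor bound, the linear term vanishes and the quadratic one sees only the
    covariance [step_cov]. The lower bound [step_mean_ge] has the same terms up to second order, so
    their difference is of order [s ^+ 3]. *)
Lemma gaussian_mean_le C F x a b (s : R) : 0 <= s -> smooth F ->
  (forall y, 0 <= F y) -> taylor2 C F x a b ->
  (gaussian_mean s (EFin \o F) x <=
   (F x + s ^+ 2 * (\sum_j \sum_i b j i * step_cov j i) + C * s ^+ 3 * M)%:E)%E.
Proof.
move=> s0 sF F0 [_ _ _ tay].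
pose h1 (y : V) := (F x)%:E.
pose h2 (y : V) := (s%:E * (lin a y)%:E)%E.
pose h3 (y : V) := ((s ^+ 2)%:E * \sum_j \sum_i (b j i)%:E * (y j * y i)%:E)%E.
pose h4 (y : V) := ((C * s ^+ 3)%:E * (norm1 y ^+ 3)%:E)%E.
have i1 : mu.-integrable setT h1 by exact: finite_measure_integrable_cst.
have i2 : mu.-integrable setT h2.
  by apply: integrableZl => //; exact: integrable_linear_form.
have i3ji j i : mu.-integrable setT (fun y : V => ((b j i)%:E * (y j * y i)%:E)%E).
  by apply: integrableZl => //; exact: integrable_gaussian_coordM.
have i3j j : mu.-integrable setT
    (fun y : V => \sum_i ((b j i)%:E * (y j * y i)%:E)%E).
  exact: integrable_sum.
have i3 : mu.-integrable setT h3.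
  by apply: integrableZl => //; exact: integrable_sum.
have i4 : mu.-integrable setT h4.
  by apply: integrableZl => //; exact: integrable_norm1_cube.
have i12 := integrableD measurableT i1 i2.
have i123 := integrableD measurableT i12 i3.
have i1234 := integrableD measurableT i123 i4.
have hE y : (h1 y + h2 y + h3 y + h4 y)%E =
    (F x + s * lin a y + s ^+ 2 * quad b y + C * s ^+ 3 * norm1 y ^+ 3)%:E.
  rewrite /h1 /h2 /h3 /h4.
  have -> : (\sum_j \sum_i (b j i)%:E * (y j * y i)%:E)%E = (quad b y)%:E.
    rewrite -sumEFin; apply: eq_bigr => j _.
    by rewrite -sumEFin; apply: eq_bigr => i _.
  by rewrite -!EFinM -!EFinD.
apply: (@le_trans _ _ (\int[mu]_y (h1 y + h2 y + h3 y + h4 y))%E).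
  apply: ge0_le_integral => //.
  - by move=> y _; rewrite lee_fin.
  - apply/measurable_EFinP.
    exact: (measurableT_comp sF.1 (measurable_translate_scale x s)).
  - by case/integrableP : i1234.
  - move=> y _; rewrite hE lee_fin /=.
    have := tay (fun j => s * y j); rewrite ler_norml => /andP[_].
    by rewrite lin_scale quad_scale norm1_scale// exprMn !mulrA; lra.
rewrite integralD//= integralD//= integralD//=.
rewrite /h1 /h2 /h3 /h4 integral_cst// [X in (_ * X)%E](probability_setT mu) mule1.
rewrite integralZl//; last exact: integrable_linear_form.
have -> : (\int[mu]_y (lin a y)%:E = 0)%E.
  by have := expectation_linear_form limit_vectors a; rewrite unlock.
rewrite mule0 adde0 integralZl//; last exact: integrable_sum.
rewrite integral_sum//.
have -> : (\sum_j \int[mu]_y \sum_i (b j i)%:E * (y j * y i)%:E)%E =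
    (\sum_j \sum_i b j i * step_cov j i)%:E.
  rewrite -sumEFin; apply: eq_bigr => j _.
  rewrite integral_sum// -sumEFin; apply: eq_bigr => i _.
  rewrite integralZl//; last exact: integrable_gaussian_coordM.
  by rewrite integral_gaussian_coordM limit_vectors_cov -EFinM.
rewrite integralZl//; last exact: integrable_norm1_cube.
rewrite -[X in (_ + _ * X)%E]fineK; last first.
  exact: integrable_fin_num integrable_norm1_cube.
by rewrite -!EFinM -!EFinD.
Qed.

Lemma step_mean_ge C F x a b (s : R) : 0 <= s -> taylor2 C F x a b ->
  F x + s ^+ 2 * (\sum_j \sum_i b j i * step_cov j i) - C * s ^+ 3 * M' <=
  \sum_k p k * F (fun j => x j + s * g k j).
Proof.
move=> s0 [_ _ _ tay].
have lin0 : \sum_k p k * lin a (g k) = 0.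
  under eq_bigr do rewrite /lin mulr_sumr.
  rewrite exchange_big /= big1// => j _.
  under eq_bigr do rewrite mulrCA.
  by rewrite -mulr_sumr g_mean mulr0.
have quadE : \sum_k p k * quad b (g k) = \sum_j \sum_i b j i * step_cov j i.
  under eq_bigr do rewrite /quad mulr_sumr.
  rewrite exchange_big /=; apply: eq_bigr => j _.
  under eq_bigr do rewrite mulr_sumr.
  rewrite exchange_big /=; apply: eq_bigr => i _.
  by rewrite mulr_sumr; apply: eq_bigr => k _; rewrite mulrCA.
have -> : F x + s ^+ 2 * (\sum_j \sum_i b j i * step_cov j i) -
    C * s ^+ 3 * M' = \sum_k p k * (F x + s * lin a (g k) +
      s ^+ 2 * quad b (g k) - C * s ^+ 3 * norm1 (g k) ^+ 3).
  under [RHS]eq_bigr do rewrite mulrBr !mulrDr.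
  rewrite sumrB !big_split /= -mulr_suml p_sum mul1r.
  have -> : \sum_k p k * (s * lin a (g k)) = s * 0.
    by rewrite -[in RHS]lin0 mulr_sumr; apply: eq_bigr => k _; rewrite mulrCA.
  have -> : \sum_k p k * (s ^+ 2 * quad b (g k)) =
      s ^+ 2 * (\sum_j \sum_i b j i * step_cov j i).
    by rewrite -quadE mulr_sumr; apply: eq_bigr => k _; rewrite mulrCA.
  rewrite mulr0 addr0; congr (_ - _).
  by rewrite /M' mulr_sumr; apply: eq_bigr => k _; rewrite mulrCA.
apply: ler_sum => k _; apply: ler_wpM2l => //.
have := tay (fun j => s * g k j); rewrite ler_norml => /andP[+ _].
by rewrite lin_scale quad_scale norm1_scale// exprMn !mulrA; lra.
Qed.

End lindeberg_replacement.

(** * Lindeberg's replacement over many steps *)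

Section central_limit.
Context (R : realType) (I K : finType) (p : K -> R) (g : K -> I -> R).
Hypotheses (p_ge0 : forall k, 0 <= p k) (p_sum : \sum_k p k = 1).
Hypothesis g_mean : forall j, \sum_k p k * g k j = 0.
Local Notation V := (borel_pow R I).
Local Notation mu := (gaussian_sum (limit_vectors p g)).
Local Notation Vm := (step_mean p g).
Local Notation Qm := (gaussian_mean p g).
Implicit Types (x : I -> R) (F : V -> R) (G H : V -> \bar R).

Lemma gaussian_meanE s G : measurable_ge0 G ->
  Qm s G = gshifts (vscale s (limit_vectors p g)) G.
Proof.
move=> mG; apply/funext => x; rewrite /gaussian_mean.
rewrite (integral_gaussian_sum _
  (measurable_ge0_comp mG (measurable_translate_scale x s))).
rewrite gshifts_scale; congr gshifts.
by apply/funext => j; rewrite mulr0 addr0.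
Qed.

Lemma measurable_ge0_gaussian_mean s G : measurable_ge0 G -> measurable_ge0 (Qm s G).
Proof. by move=> mG; rewrite gaussian_meanE//; exact: measurable_ge0_gshifts. Qed.

Lemma gaussian_mean_comp s t G : measurable_ge0 G ->
  Qm s (Qm t G) = Qm (Num.sqrt (s ^+ 2 + t ^+ 2)) G.
Proof.
move=> mG; rewrite [RHS]gaussian_meanE// [Qm t G]gaussian_meanE//.
rewrite gaussian_meanE ?gshifts_scale_merge//; exact: measurable_ge0_gshifts.
Qed.

Lemma gaussian_mean_mono s G H x : measurable_ge0 G -> measurable_ge0 H ->
  (forall y, (G y <= H y)%E) -> (Qm s G x <= Qm s H x)%E.
Proof.
move=> mG mH GH; apply: ge0_le_integral => //.
- by move=> y _; exact: mG.2.
- exact: (measurable_ge0_comp mG (measurable_translate_scale x s)).1.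
- exact: (measurable_ge0_comp mH (measurable_translate_scale x s)).1.
Qed.

Lemma gaussian_mean_addc s G (c : R) x : measurable_ge0 G -> 0 <= c ->
  Qm s (fun y => G y + c%:E)%E x = (Qm s G x + c%:E)%E.
Proof.
move=> mG c0; rewrite /gaussian_mean ge0_integralD//.
- by rewrite integral_cst// [X in (_ * X)%E](probability_setT mu) mule1.
- by move=> y _; exact: mG.2.
- exact: (measurable_ge0_comp mG (measurable_translate_scale x s)).1.
Qed.

Lemma gaussian_mean_step_mean s t G : measurable_ge0 G ->
  Qm t (Vm s G) = Vm s (Qm t G).
Proof.
move=> mG; apply/funext => x; rewrite /gaussian_mean /step_mean.
pose y' (k : K) (y : I -> R) : V := fun j => x j + t * y j + s * g k j.
have my k : measurable_fun [set: V] (y' k).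
  apply: measurable_fun_borel_pow => j; apply: measurable_funD => //.
  apply: measurable_funD => //.
  by apply: measurable_funM => //; exact: measurable_borel_pow_coord.
have mGk k := measurable_ge0_comp mG (my k).
rewrite ge0_integral_sum//.
- apply: eq_bigr => k _; rewrite ge0_integralZl//.
  + congr (_ * _)%E; apply: eq_integral => y _; congr G.
    by apply/funext => j; rewrite addrAC.
  + exact: (mGk k).1.
  + by move=> y _; exact: mG.2.
  + by rewrite lee_fin.
- by move=> k; apply: measurable_funeM; exact: (mGk k).1.
- by move=> k y _; rewrite mule_ge0 ?lee_fin//; exact: mG.2.
Qed.

Lemma step_mean_mono s G H x : (forall y, (G y <= H y)%E) -> (Vm s G x <= Vm s H x)%E.
Proof.
by move=> GH; apply: lee_sum => k _; apply: lee_wpmul2l; rewrite ?lee_fin.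
Qed.

Lemma step_mean_addc s G (c : R) x : measurable_ge0 G -> 0 <= c ->
  Vm s (fun y => G y + c%:E)%E x = (Vm s G x + c%:E)%E.
Proof.
move=> mG c0; rewrite /step_mean.
transitivity (\sum_(k : K) ((p k)%:E * G (fun j => x j + s * g k j)%R +
    (p k)%:E * c%:E))%E.
  by apply: eq_bigr => k _; rewrite ge0_muleDr ?lee_fin//; exact: mG.2.
rewrite big_split /=; congr (_ + _)%E.
by under eq_bigr do rewrite -EFinM; rewrite sumEFin -mulr_suml p_sum mul1r.
Qed.

Lemma measurable_ge0_iter_step s G m : measurable_ge0 G ->
  measurable_ge0 (iter m (Vm s) G).
Proof. by move=> mG; elim: m => //= m IH; exact: measurable_ge0_step_mean. Qed.

Lemma gaussian_mean_iter s t G m : measurable_ge0 G ->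
  Qm t (iter m (Vm s) G) = iter m (Vm s) (Qm t G).
Proof.
move=> mG; elim: m => //= m IH; rewrite gaussian_mean_step_mean ?IH//.
exact: measurable_ge0_iter_step.
Qed.

Lemma iter_step_mono_addc s G H (c : R) m x : measurable_ge0 H -> 0 <= c ->
  (forall y, (G y <= H y + c%:E)%E) ->
  (iter m (Vm s) G x <= iter m (Vm s) H x + c%:E)%E.
Proof.
move=> mH c0 GH; elim: m x => //= m IH x.
rewrite -step_mean_addc//; last exact: measurable_ge0_iter_step.
exact: step_mean_mono.
Qed.

(** One Gaussian step is split off and the induction hypothesis applied under it. Commuting that
    step past [iter m (Vm s)] makes it act on [G] itself, so the one-step comparison is needed for
    [G] alone and not for its iterates. Each step then costs the same [delta]. *)
Lemma lindeberg (s delta : R) G m x : measurable_ge0 G -> 0 <= s -> 0 <= delta ->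
  (forall y, (Qm s G y <= Vm s G y + delta%:E)%E) ->
  (Qm (Num.sqrt m%:R * s) G x <= iter m (Vm s) G x + (m%:R * delta)%:E)%E.
Proof.
move=> mG s0 d0 QV; elim: m x => [|m IH] x.
  rewrite sqrtr0 !mul0r adde0 /gaussian_mean.
  rewrite (_ : (fun y => _) = cst (G x)).
    by rewrite integral_cst// [X in (_ * X)%E](probability_setT mu) mule1.
  by apply/funext => y; congr G; apply/funext => j; rewrite mul0r addr0.
have -> : Num.sqrt m.+1%:R * s = Num.sqrt (s ^+ 2 + (Num.sqrt m%:R * s) ^+ 2).
  rewrite exprMn sqr_sqrtr//.
  have -> : s ^+ 2 + m%:R * s ^+ 2 = m.+1%:R * s ^+ 2 by rewrite -natr1; ring.
  by rewrite sqrtrM// sqrtr_sqr ger0_norm.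
rewrite -gaussian_mean_comp//.
have md0 : 0 <= m%:R * delta by rewrite mulr_ge0.
have mI := measurable_ge0_iter_step s m mG.
apply: (@le_trans _ _ (Qm s (fun y => iter m (Vm s) G y + (m%:R * delta)%:E)%E x)).
  apply: gaussian_mean_mono => //; first exact: measurable_ge0_gaussian_mean.
  split=> [|y]; first by apply: emeasurable_funD => //; exact: mI.1.
  by rewrite adde_ge0 ?lee_fin//; exact: mI.2.
rewrite gaussian_mean_addc// gaussian_mean_iter//.
have -> : (m.+1%:R * delta)%:E = (delta%:E + (m%:R * delta)%:E)%E.
  by rewrite -EFinD; congr _%:E; rewrite -natr1; ring.
rewrite addeA leeD2r// -[iter m.+1 _ _]/(Vm s (iter m (Vm s) G)) -iterS iterSr.
by apply: iter_step_mono_addc => //; exact: measurable_ge0_step_mean.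
Qed.

Lemma gaussian_mean_le_step F : smooth F -> (forall y, 0 <= F y) ->
  exists C : R, 0 <= C /\ forall s x, 0 <= s ->
    (Qm s (EFin \o F) x <= Vm s (EFin \o F) x + (C * s ^+ 3)%:E)%E.
Proof.
move=> sF F0; have [mF [C [C0 hC]]] := sF.
pose M := fine (\int[mu]_y (norm1 y ^+ 3)%:E)%E.
pose M' := \sum_k p k * norm1 (g k) ^+ 3.
have M0 : 0 <= M.
  by apply: fine_ge0; apply: integral_ge0 => y _; rewrite lee_fin exprn_ge0 ?norm1_ge0.
have M'0 : 0 <= M'.
  by apply: sumr_ge0 => k _; rewrite mulr_ge0// exprn_ge0 ?norm1_ge0.
exists (C * (M + M')); split => [|s x s0]; first by rewrite mulr_ge0// addr_ge0.
have [a [b tay]] := hC x.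
apply: le_trans; first exact: (gaussian_mean_le g p_ge0 s0 sF F0 tay).
have := step_mean_ge p_ge0 p_sum g_mean s0 tay; rewrite -/M -/M'.
have -> : Vm s (EFin \o F) x =
    (\sum_k p k * F (fun j => x j + s * g k j)%R)%:E.
  by rewrite -sumEFin; apply: eq_bigr => k _; rewrite -EFinM.
rewrite -EFinD lee_fin => H.
have -> : C * (M + M') * s ^+ 3 = C * s ^+ 3 * M + C * s ^+ 3 * M' by ring.
by rewrite addrA; lra.
Qed.

Context d (T : measurableType d) (P : probability T R) (X : nat -> T -> K) (k0 : K).
Hypothesis mX : forall i k, measurable [set w | X i w = k].
Hypothesis indepX : forall (J : {fset nat}) (k : nat -> K),
  (P (\bigcap_(i in [set` J]) [set w | X i w = k i]) = (\prod_(i <- J) p (k i))%:E)%E.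

Definition normalized_sum n w : V := fun j =>
  (Num.sqrt n%:R)^-1 * \sum_(1 <= i < n.+1) g (X i w) j.

(** With [s = 1 / sqrt n] the merged Gaussian steps have total scale [sqrt n * s = 1], hence law
    [mu], and the total cost is [n * (C * s ^+ 3) = C / sqrt n]. *)
Lemma smooth_liminf F : smooth F -> (forall y, 0 <= F y) -> exists C : R, 0 <= C /\
  forall n, (0 < n)%N -> (\int[mu]_y (F y)%:E <=
    \int[P]_w (F (normalized_sum n w))%:E + (C / Num.sqrt n%:R)%:E)%E.
Proof.
move=> sF F0; have [C [C0 hC]] := gaussian_mean_le_step sF F0.
exists C; split => // n n0.
pose s : R := (Num.sqrt n%:R)^-1.
have r0 : 0 < Num.sqrt (n%:R : R) by rewrite sqrtr_gt0 ltr0n.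
have s0 : 0 <= s by rewrite invr_ge0 ltW.
have mF := measurable_ge0_smooth sF F0.
have d0 : 0 <= C * s ^+ 3 by rewrite mulr_ge0// exprn_ge0.
have := lindeberg n (fun=> 0) mF s0 d0 (fun y => hC s y s0).
rewrite /s divff ?gt_eqF// -/s -(integral_walk g mX p_ge0 indepX s n k0 mF).
have -> : n%:R * (C * s ^+ 3) = C / Num.sqrt n%:R.
  have nE : n%:R = Num.sqrt n%:R ^+ 2 :> R by rewrite sqr_sqrtr.
  by rewrite {1}nE /s; field; rewrite gt_eqF.
rewrite /gaussian_mean /=.
have -> : (\int[mu]_y (F (fun j => 0 + 1 * y j))%:E = \int[mu]_y (F y)%:E)%E.
  apply: eq_integral => y _; congr (F _)%:E.
  by apply/funext => j; rewrite add0r mul1r.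
by [].
Qed.

End central_limit.

(** * Convergence in distribution *)

Section bounded_expectation.
Context (R : realType) d (T : measurableType d) (P : probability T R).

(** A bounded test function is rescaled affinely into [[0, 1]] and back; real values of the
    expectations turn this into plain arithmetic. *)
Lemma integral_bounded_affine (h : T -> R) (M : R) : measurable_fun setT h ->
  (forall w, `|h w| <= M) -> exists r, (\int[P]_w (h w)%:E = r%:E)%E /\
    forall a b : R, (\int[P]_w (a * h w + b)%:E = (a * r + b)%:E)%E.
Proof.
move=> mh hM.
have ih : P.-integrable setT (EFin \o h).
  apply: (@le_integrable _ _ _ P setT measurableT _ (fun=> M%:E)).
  - exact/measurable_EFinP.
  - by move=> w _; rewrite /= lee_fin (le_trans (hM w))// ler_norm.
  - exact: finite_measure_integrable_cst.
have hfin := integrable_fin_num measurableT ih.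
exists (fine (\int[P]_w (h w)%:E)%E); split; first by rewrite fineK.
move=> a b.
transitivity (\int[P]_w (a%:E * (h w)%:E + b%:E))%E.
  by apply: eq_integral => w _; rewrite -EFinM -EFinD.
rewrite integralD//; last 2 first.
- exact: integrableZl.
- exact: finite_measure_integrable_cst.
rewrite integralZl// integral_cst// [X in (_ + _ * X)%E](probability_setT P) mule1.
by rewrite EFinD EFinM fineK.
Qed.

End bounded_expectation.

Section convergence.
Context (R : realType) (I K : finType) (p : K -> R) (g : K -> I -> R).
Hypotheses (p_ge0 : forall k, 0 <= p k) (p_sum : \sum_k p k = 1).
Hypothesis g_mean : forall j, \sum_k p k * g k j = 0.
Local Notation V := (borel_pow R I).
Local Notation mu := (gaussian_sum (limit_vectors p g)).
Context d (T : measurableType d) (P : probability T R) (X : nat -> T -> K) (k0 : K).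
Hypothesis mX : forall i k, measurable [set w | X i w = k].
Hypothesis indepX : forall (J : {fset nat}) (k : nat -> K),
  (P (\bigcap_(i in [set` J]) [set w | X i w = k i]) = (\prod_(i <- J) p (k i))%:E)%E.

Lemma measurable_normalized_sum n :
  measurable_fun [set: T] (normalized_sum g X n : T -> V).
Proof.
have := measurable_walk g mX (Num.sqrt n%:R)^-1 (fun=> 0) n.
congr (measurable_fun _ _); apply/funext => w; apply/funext => j.
by rewrite add0r.
Qed.

Lemma continuous_liminf (f : V -> R) (e : R) :
  continuous (f : {ptws I -> R} -> R) -> (forall y, 0 <= f y <= 1) -> 0 < e ->
  \forall n \near \oo, (\int[mu]_y (f y)%:E <=
     \int[P]_w (f (normalized_sum g X n w))%:E + e%:E)%E.
Proof.
move=> cf f01 e0; have e20 : 0 < e / 2 by rewrite divr_gt0.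
have [F [sF Ff Fe]] := lower_approximable_continuous mu cf f01 e20.
have F0 y : 0 <= F y by have /andP[] := Ff y.
have [C [C0 hC]] := smooth_liminf p_ge0 p_sum g_mean k0 mX indepX sF F0.
have mf := continuous_measurable_borel_pow cf.
near=> n.
have n0 : (0 < n)%N by near: n; exact: nbhs_infty_gt.
have Cn : C / Num.sqrt n%:R <= e / 2.
  have r0 : 0 < Num.sqrt (n%:R : R) by rewrite sqrtr_gt0 ltr0n.
  have nC : (2 * C / e) ^+ 2 <= n%:R :> R by near: n; exact: nbhs_infty_ger.
  have : 2 * C / e <= Num.sqrt n%:R.
    rewrite -[leLHS]ger0_norm ?divr_ge0 ?mulr_ge0 ?(ltW e0)//.
    by rewrite -sqrtr_sqr ler_wsqrtr.
  rewrite ler_pdivrMr// => h; rewrite ler_pdivrMr//; lra.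
apply: le_trans Fe _; apply: le_trans (leeD2r _ (hC n n0)) _.
have -> : e%:E = ((e / 2)%:E + (e / 2)%:E)%E by rewrite -EFinD; congr _%:E; field.
rewrite -addeA leeD//; last by rewrite -!EFinD lee_fin lerD2r.
have mZ := measurable_normalized_sum n.
apply: ge0_le_integral => //.
- by move=> w _; rewrite lee_fin.
- by apply/measurable_EFinP; exact: (measurableT_comp sF.1 mZ).
- by apply/measurable_EFinP; exact: (measurableT_comp mf mZ).
- by move=> w _; rewrite lee_fin; have /andP[] := Ff (normalized_sum g X n w).
Unshelve. all: by end_near. Qed.

Lemma normalized_sum_converges :
  converges_in_distribution P (normalized_sum g X) mu.
Proof.
move=> f cf [M0 [_ hM0]].
(* [bounded_fun] gives a bound for every number strictly above [M0]; the 1 in the maximum makes [M]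
   positive and thus invertible. *)
pose M := Num.max 1 (M0 + 1).
have M1 : 1 <= M by rewrite /M le_max lexx.
have MM0 : M0 < M by rewrite /M lt_max ltrDl ltr01 orbT.
have fM y : `|f y| <= M by exact: (hM0 M MM0 y Logic.I).
have mf := continuous_measurable_borel_pow cf.
have [r [rE rA]] := integral_bounded_affine mu mf fM.
have /choice[u uE] : forall n, exists u : R,
    (\int[P]_w (f (normalized_sum g X n w))%:E = u%:E)%E /\
    forall a b : R, (\int[P]_w (a * f (normalized_sum g X n w) + b)%:E =
      (a * u + b)%:E)%E.
  move=> n; exact: (integral_bounded_affine P
    (measurableT_comp mf (measurable_normalized_sum n)) (fun w => fM _)).
rewrite unlock rE.
have -> : (fun n => (\int[P]_w ((f \o normalized_sum g X n) w)%:E)%E) =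
    EFin \o u by apply/funext => n; rewrite /= (uE n).1.
apply: cvg_EFin; first exact: nearW.
have M20 : 0 < 2 * M by rewrite mulr_gt0// (lt_le_trans ltr01).
(* For [a] equal to [k] or [- k], [a * f] lies in [[-1/2, 1/2]], so [a * f + 1/2] has values in
   [[0, 1]]. The two signs give the two one-sided bounds. *)
pose k := (2 * M)^-1; have k0' : 0 < k by rewrite invr_gt0.
have kM : k * M = 2^-1 by rewrite /k; field; rewrite gt_eqF// (lt_le_trans ltr01).
have one_sided (a : R) : `|a| = k -> forall e : R, 0 < e ->
    \forall n \near \oo, a * r <= a * u n + e.
  move=> ak e e0.
  have caf : continuous ((fun y => a * f y + 2^-1) : {ptws I -> R} -> R).
    have caff : continuous (fun t : R => a * t + 2^-1 : R).
      by move=> t; apply: cvgD; [apply: cvgMr; exact: cvg_id|exact: cvg_cst].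
    by move=> y; apply: (@continuous_comp _ _ _ f (fun t : R => a * t + 2^-1));
      [exact: cf|exact: caff].
  have af01 y : 0 <= a * f y + 2^-1 <= 1.
    have : `|a * f y| <= 2^-1 by rewrite normrM ak -kM ler_wpM2l// ltW.
    by rewrite ler_norml => /andP[h1 h2]; apply/andP; split; lra.
  have := continuous_liminf caf af01 e0; apply: filterS => n.
  by rewrite rA (uE n).2 -EFinD lee_fin; lra.
suff near_e (e : R) : 0 < e -> \forall n \near \oo, `|r - u n| <= e.
  by apply/cvgrPdist_le => e; exact: near_e.
move=> e0.
have ek : 0 < k * e by rewrite mulr_gt0.
have h1 := one_sided k (gtr0_norm k0') _ ek.
have h2 := one_sided (- k) (etrans (normrN k) (gtr0_norm k0')) _ ek.
near=> n.
have c1 : k * r <= k * u n + k * e by near: n.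
have c2 : - k * r <= - k * u n + k * e by near: n.
rewrite ler_norml; apply/andP; split; rewrite -(ler_pM2l k0').
  by rewrite mulrN mulrBr; lra.
by rewrite mulrBr; lra.
Unshelve. all: by end_near. Qed.

End convergence.

(** * Corners under the uniform law *)

Section corner_law.
Context (R : realType) (d : nat).
Implicit Types (c : corner d) (x : d.-tuple R).

Let side c x (k : 'I_d) : set R :=
  if c k then `[tnth x k, 1]%classic else `[0, tnth x k]%classic.

Let measurable_side c x k : measurable (side c x k).
Proof. by rewrite /side; case: ifP. Qed.

(** The cube supplies the missing endpoint 0 or 1 of each one-sided condition, and [unit_cube x]
    supplies the converse. The box form is what the product formula [uniform_cube_box] accepts. *)
Lemma cornerLe_box c x : unit_cube x ->
  cornerLe c x = [set s | forall k, side c x k (tnth s k)].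
Proof.
move=> hx; apply/seteqP; split => s /=.
  move=> [hs cs] k; have := cs k; have /andP[s0 s1] := hs k; rewrite /side.
  by case: ifP => _ ?; rewrite /= in_itv/=; apply/andP.
move=> h; split => k; have := h k; have /andP[x0 x1] := hx k; rewrite /side;
  case: ifP => _; rewrite /= in_itv/= => /andP[h1 h2] //.
- by rewrite (le_trans x0 h1).
- by rewrite h1 (le_trans h2 x1).
Qed.

Lemma measurable_cornerLe c x : unit_cube x -> measurable (cornerLe c x).
Proof.
move=> hx; rewrite cornerLe_box// [X in measurable X](_ : _ =
  \bigcap_(k in [set: 'I_d]) ((fun s : d.-tuple R => tnth s k) @^-1` side c x k)).
  apply: fin_bigcap_measurable; first exact: finite_finset.
  move=> k _; rewrite -[X in measurable X]setTI.
  by apply: measurable_tnth => //; exact: measurable_side.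
by apply/seteqP; split => s /= h k => [_|]; [exact: h|exact: (h k Logic.I)].
Qed.

Lemma uniform_prob_itv (a b : R) : 0 <= a -> a <= b -> b <= 1 ->
  uniform_prob (@ltr01 R) `[a, b]%classic = (b - a)%:E.
Proof.
move=> a0 ab b1; rewrite /uniform_prob.
transitivity (\int[lebesgue_measure]_(t in `[a, b]%classic) (1%:E : \bar R))%E.
  apply: eq_integral => t; rewrite inE /= in_itv /= => /andP[ta tb].
  by rewrite /uniform_pdf (le_trans a0 ta) (le_trans tb b1) /= subr0 invr1.
rewrite integral_cst//= mul1e lebesgue_measure_itv /= lte_fin.
by case: ltgtP ab => // -> _; rewrite subrr.
Qed.

Lemma uniform_cube_cornerLe c x : unit_cube x ->
  uniform_cube R d (cornerLe c x) = (cornerF c x)%:E.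
Proof.
move=> hx; rewrite cornerLe_box// uniform_cube_box; last exact: measurable_side.
rewrite /cornerF -prodEFin; apply: eq_bigr => k _.
have /andP[x0 x1] := hx k; rewrite /side; case: ifP => _.
  by rewrite uniform_prob_itv.
by rewrite uniform_prob_itv// subr0.
Qed.

End corner_law.

(** * Patterns of membership and their moments *)

Section finite_classification.
Context (R : realType) d (T : measurableType d) (m : probability T R).
Context (K : finType) (phi : T -> K).
Hypothesis mphi : forall k, measurable [set z | phi z = k].

(** Total mass, means and products of pattern coordinates all come from this formula, each with its
    own Boolean predicate. *)
Lemma probability_classify (Q : pred K) :
  fine (m [set z | Q (phi z)]) =
  \sum_k fine (m [set z | phi z = k]) * (Q k)%:R.
Proof.
have mQ : measurable [set z | Q (phi z)].
  rewrite [X in measurable X](_ : _ =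
    \bigcup_(k in [set k | Q k]) [set z | phi z = k]).
    by apply: fin_bigcup_measurable => //; exact: finite_finset.
  by apply/seteqP; split => [z Qz|z [k Qk /= ->]//]; exists (phi z).
have -> : m [set z | Q (phi z)] =
    (\sum_k (Q k)%:R%:E * m [set z | phi z = k])%E.
  transitivity (\int[m]_z (\1_[set z | Q (phi z)] z)%:E)%E.
    by rewrite integral_indic// setIT.
  transitivity (\int[m]_z \sum_k (Q k)%:R%:E * (\1_[set z | phi z = k] z)%:E)%E.
    apply: eq_integral => z _; rewrite (bigD1 (phi z))//= big1 => [|k kz].
      rewrite adde0 [X in (_ * X%:E)%E]indicE mem_set// mule1 indicE.
      by congr (_%:R%:E); congr nat_of_bool; apply/idP/idP => [/set_mem|?]//;
        exact/mem_set.
    rewrite indicE memNset ?mule0//= => zk.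
    by move: kz; rewrite zk eqxx.
  have mind k : measurable_fun setT (fun z : T => (\1_[set z | phi z = k] z : R)%:E).
    by apply/measurable_EFinP; exact: measurable_indic.
  rewrite ge0_integral_sum//.
  - apply: eq_bigr => k _; rewrite ge0_integralZl//.
    by rewrite integral_indic// setIT.
  - by move=> k; exact: measurable_funeM.
rewrite -sum_fine => [|k _]; last by rewrite fin_numM// fin_num_measure.
by apply: eq_bigr => k _; rewrite fineM ?fin_num_measure//= mulrC.
Qed.

End finite_classification.

Section indicator_patterns.
Context (R : realType) d (T : measurableType d) (m : probability T R).
Context (I : finType) (A : I -> set T).
Hypothesis mA : forall j, measurable (A j).

Definition pattern (z : T) : {ffun I -> bool} := [ffun j => z \in A j].

Definition pattern_prob (k : {ffun I -> bool}) : R :=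
  fine (m [set z | pattern z = k]).

Definition centered_pattern (k : {ffun I -> bool}) (j : I) : R :=
  (k j)%:R - fine (m (A j)).

Lemma measurable_pattern k : measurable [set z | pattern z = k].
Proof.
have -> : [set z | pattern z = k] =
    \bigcap_(j in [set: I]) (if k j then A j else ~` A j).
  apply/seteqP; split => [z /= <- j _|z h]; last first.
    apply/ffunP => j; have := h j Logic.I; rewrite ffunE.
    by case: (k j) => hj; [exact: mem_set|exact: memNset].
  rewrite ffunE; case: ifPn => [zA|/negP zA]; first exact: set_mem.
  by move=> zA'; apply: zA; exact: mem_set.
apply: fin_bigcap_measurable; first exact: finite_finset.
by move=> j _; case: ifP => // _; exact: measurableC.
Qed.

Lemma pattern_prob_ge0 k : 0 <= pattern_prob k.
Proof. exact: fine_ge0. Qed.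

Lemma pattern_prob_sum : \sum_k pattern_prob k = 1.
Proof.
have := probability_classify m measurable_pattern predT.
rewrite (_ : [set z | predT (pattern z)] = setT); last exact/seteqP.
rewrite probability_setT /= => ->.
by apply: eq_bigr => k _; rewrite mulr1.
Qed.

Lemma pattern_prob_mem j : \sum_k pattern_prob k * (k j)%:R = fine (m (A j)).
Proof.
rewrite -(probability_classify m measurable_pattern (fun k => k j)).
congr (fine (m _)); apply/seteqP; split => z /=; rewrite ffunE.
  exact: set_mem.
exact: mem_set.
Qed.

Lemma pattern_prob_memI j l :
  \sum_k pattern_prob k * ((k j)%:R * (k l)%:R) = fine (m (A j `&` A l)).
Proof.
transitivity (\sum_k pattern_prob k * (k j && k l)%:R).
  by apply: eq_bigr => k _; rewrite -natrM mulnb.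
rewrite -(probability_classify m measurable_pattern (fun k => k j && k l)).
congr (fine (m _)); apply/seteqP; split => z /=; rewrite !ffunE.
  by move=> /andP[/set_mem ? /set_mem].
by move=> [? ?]; apply/andP; split; exact/mem_set.
Qed.

Lemma centered_pattern_mean j :
  \sum_k pattern_prob k * centered_pattern k j = 0.
Proof.
under eq_bigr do rewrite /centered_pattern mulrBr.
by rewrite sumrB pattern_prob_mem -mulr_suml pattern_prob_sum mul1r subrr.
Qed.

Lemma centered_pattern_cov j l :
  step_cov pattern_prob centered_pattern j l =
  fine (m (A j `&` A l)) - fine (m (A j)) * fine (m (A l)).
Proof.
rewrite /step_cov /centered_pattern.
set a := fine (m (A j)); set b := fine (m (A l)).
transitivity (\sum_k (pattern_prob k * ((k j)%:R * (k l)%:R)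
    - b * (pattern_prob k * (k j)%:R) - a * (pattern_prob k * (k l)%:R)
    + a * b * pattern_prob k)).
  by apply: eq_bigr => k _; ring.
rewrite big_split sumrB sumrB /= -!mulr_sumr pattern_prob_memI !pattern_prob_mem.
by rewrite pattern_prob_sum -/a -/b; ring.
Qed.

End indicator_patterns.

Lemma iid_pattern_prob (R : realType) d d' (T : measurableType d)
    (T' : measurableType d') (P : probability T R) (m : probability T' R)
    (X : nat -> {RV P >-> T'}) (I : finType) (A : I -> set T')
    (J : {fset nat}) (k : nat -> {ffun I -> bool}) :
  (forall j, measurable (A j)) -> iid_with_law X m ->
  (P (\bigcap_(i in [set` J]) [set w | pattern A (X i w) = k i]) =
   (\prod_(i <- J) pattern_prob m A (k i))%:E)%E.
Proof.
move=> mA [indX lawX].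
have mC i : measurable [set z | pattern A z = k i] by exact: measurable_pattern.
rewrite (indX J (fun i => [set z | pattern A z = k i]) mC) -prodEFin.
apply: eq_bigr => i _; rewrite /pattern_prob fineK ?fin_num_measure//.
exact: (lawX i _ (mC i)).
Qed.

(* X 0 plays the role of X, and X i that of X_i for 1 <= i. *)
Theorem theorem3p8 (R : realType) (d : nat) (hd : (0 < d)%N)
    (disp : measure_display) (T : measurableType disp) (P : probability T R)
    (X : nat -> {RV P >-> d.-tuple R})
    (hX : iid_with_law X (uniform_cube R d))
    (I : finType) (c : I -> corner d) (x : I -> d.-tuple R)
    (hx : forall j, unit_cube (x j)) :
  exists mu : probability (borel_pow R I) R,
    is_gaussian_law mu (fun=> 0)
      (fun j l =>
         fine (P (X 0%N @^-1` (cornerLe (c j) (x j) `&` cornerLe (c l) (x l))))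
         - cornerF (c j) (x j) * cornerF (c l) (x l)) /\
    converges_in_distribution P
      (fun n w j => empirical_process X n (c j) (x j) w) mu.
Proof.
pose m := uniform_cube R d.
pose A j := cornerLe (c j) (x j).
have mA j : measurable (A j) by exact: measurable_cornerLe.
have mAE j : fine (m (A j)) = cornerF (c j) (x j).
  by rewrite uniform_cube_cornerLe.
pose p := pattern_prob m A; pose g := centered_pattern m A.
exists (gaussian_sum (limit_vectors p g)); split.
  have -> : (fun j l => fine (P (X 0%N @^-1` (A j `&` A l))) -
      cornerF (c j) (x j) * cornerF (c l) (x l)) =
      (fun j l => \sum_(v <- limit_vectors p g) v j * v l).
    apply/funext => j; apply/funext => l.
    rewrite (limit_vectors_cov _ (pattern_prob_ge0 m A)).
    rewrite (centered_pattern_cov m mA) !mAE; congr (fine _ - _).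
    (* The covariance is stated with [X 0], the patterns with the uniform law; the identical
       distribution identifies the two. *)
    by apply: (hX.2 0%N); exact: measurableI.
  exact: gaussian_sum_law.
have mpat i k : measurable [set w | pattern A (X i w) = k].
  rewrite -[X in measurable X]setTI.
  exact: (measurable_funPT (X i) measurableT _ (measurable_pattern mA k)).
have -> : (fun n w j => empirical_process X n (c j) (x j) w) =
    normalized_sum g (fun i w => pattern A (X i w)).
  apply/funext => n; apply/funext => w; apply/funext => j.
  rewrite /empirical_process /normalized_sum; congr (_ * _).
  apply: eq_bigr => i _; rewrite /g /centered_pattern mAE ffunE.
  by rewrite indicE.
(* [[ffun=> true]] is an arbitrary pattern: it supplies the values attached to the empty cylinder in
   [integral_walk]. *)
apply: (normalized_sum_converges (pattern_prob_ge0 m A) (pattern_prob_sum m mA)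
  (centered_pattern_mean m mA) [ffun=> true] mpat).
by move=> J k; exact: iid_pattern_prob.
Qed.
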